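(* Let $d\ge1$ be an integer. For each integer $i\ge1$ let $X_i$ be a nonempty compact metrizable space of finite topological dimension and $T_i:X_i\to X_i$ a homeomorphism. Let $(X,T)=\left(\prod_{i\ge1}X_i,\prod_{i\ge1}T_i\right)$ and, for $n\ge1$, let $X^{(n)}=X_1\times\cdots\times X_n$ and $T^{(n)}=T_1\times\cdots\times T_n$. If $\liminf_{n\to\infty}\mathrm{perdim}(X^{(n)},T^{(n)})<\frac d2$, then the dynamical system $(X,T)$ embeds in the shift $(([0,1]^d)^{\mathbb{Z}},\sigma)$.
   Context: Topological dimension: for a finite open cover $\alpha$ of a space $Y$, $\mathrm{ord}(\alpha)=\sup_{y\in Y}\left(\sum_{U\in\alpha}\mathbf 1_U(y)\right)-1$; a cover $\beta$ refines $\alpha$ (written $\beta\succ\alpha$) if each element of $\beta$ is contained in some element of $\alpha$; $D(\alpha)=\min_{\beta\succ\alpha}\mathrm{ord}(\beta)$, over finite open covers $\beta$ of $Y$; and $\dim(Y)=\sup_\alpha D(\alpha)$ over finite open covers $\alpha$ of $Y$. Convention: $\dim(\emptyset)=0$. For a system $(Y,S)$ ($Y$ compact metrizable, $S$ a homeomorphism) and an integer $k\ge1$, $P_k$ is the set of periodic points of $(Y,S)$ of (minimal) period at most $k$. The periodic dimension is $\mathrm{perdim}(Y,S)=\sup_{k\ge1}\frac{\dim(P_k)}{k}$. $\sigma$ is the bilateral shift $(x_i)_{i\in\mathbb{Z}}\mapsto(x_{i+1})_{i\in\mathbb{Z}}$ on $([0,1]^d)^{\mathbb{Z}}$ (product topology).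 A system $(X,T)$ embeds in $(Y,S)$ if there is a map $\phi:X\to Y$ that is a homeomorphism onto its image and satisfies $\phi\circ T=S\circ\phi$. *)

(* Defs.v *)
From HB Require Import structures.
From mathcomp Require Export all_boot all_order all_algebra.
From mathcomp Require Export all_classical all_reals all_analysis.
Export Order.TTheory GRing.Theory Num.Theory.
Export numFieldTopology.Exports.

Set Implicit Arguments.
Unset Strict Implicit.
Unset Printing Implicit Defensive.

Local Open Scope classical_set_scope.
Local Open Scope ring_scope.

Definition finite_open_cover (Y : topologicalType) (alpha : set (set Y)) :=
  [/\ finite_set alpha, (forall U, alpha U -> open U) &
      \bigcup_(U in alpha) U = [set: Y]].

Definition refines (Y : topologicalType) (beta alpha : set (set Y)) :=
  forall V, beta V -> exists2 U, alpha U & V `<=` U.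

(* Dimensions are extended reals, so that they can be infinite and be divided
   by k below. *)
Definition cover_ord (R : realType) (Y : topologicalType)
    (alpha : set (set Y)) : \bar R :=
  (ereal_sup [set (\sum_(U \in alpha) (\1_U y : R))%:E | y in [set: Y]] - 1)%E.

(* The infimum is a minimum: if Y is nonempty, the order of a finite cover is a
   natural number. For empty Y the order is -oo, and [topdim] uses the
   convention dim(empty) = 0 instead. *)
Definition cover_dim (R : realType) (Y : topologicalType)
    (alpha : set (set Y)) : \bar R :=
  ereal_inf [set cover_ord R beta | beta in
    [set beta | finite_open_cover beta /\ refines beta alpha]].

Definition topdim (R : realType) (Y : topologicalType) : \bar R :=
  if `[< [set: Y] = set0 >] then 0%E
  else ereal_sup [set cover_dim R alpha | alpha in @finite_open_cover Y].

Definition minimal_period (Y : Type) (S : Y -> Y) (y : Y) (m : nat) :=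
  [/\ (0 < m)%N, iter m S y = y &
      forall j, (0 < j < m)%N -> iter j S y <> y].

Definition periodic_points (Y : Type) (S : Y -> Y) (k : nat) : set Y :=
  [set y | exists2 m, (m <= k)%N & minimal_period S y m].

(* The dimension of P_k is that of the type [set_type P_k], which carries the
   topology induced by Y. *)
Definition perdim (R : realType) (Y : topologicalType) (S : Y -> Y) : \bar R :=
  ereal_sup [set (topdim R (set_type (periodic_points S k)) * (k%:R^-1)%:E)%E
            | k in [set k | (1 <= k)%N]].

Definition homeomorphism (X Y : topologicalType) (f : X -> Y) :=
  continuous f /\
  exists g : Y -> X, [/\ continuous g, cancel f g & cancel g f].

Definition homeomorphism_onto_image (X Y : topologicalType) (f : X -> Y) :=
  exists2 h : X -> set_type (range f),
    homeomorphism h & forall x, set_val (h x) = f x.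

Definition embeds (X : topologicalType) (T : X -> X)
    (Y : topologicalType) (S : Y -> Y) :=
  exists2 phi : X -> Y,
    homeomorphism_onto_image phi & forall x, phi (T x) = S (phi x).

Definition prod_space (I : Type) (X : I -> topologicalType) : topologicalType :=
  prod_topology X.

Definition prod_map (I : Type) (X : I -> topologicalType)
    (T : forall i, X i -> X i) : prod_space X -> prod_space X :=
  fun x i => T i (x i).

Arguments prod_map {I} X T x.

Definition cube (R : realType) (d : nat) : topologicalType :=
  prod_space (fun _ : 'I_d => set_type (`[0, 1] : set R)).

Definition shift_space (R : realType) (d : nat) : topologicalType :=
  prod_space (fun _ : int => cube R d).

Definition shift (R : realType) (d : nat) (x : shift_space R d) :
    shift_space R d :=
  fun i => x (i + 1).

(* Factors are indexed from 0, so [X i] is the (i+1)-st factor and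
   [partial_prod X n] is the product of the first n of them. *)
Definition partial_prod (X : nat -> topologicalType) (n : nat) :
    topologicalType :=
  prod_space (fun i : 'I_n => X i).

Definition partial_map (X : nat -> topologicalType)
    (T : forall i, X i -> X i) (n : nat) :
    partial_prod X n -> partial_prod X n :=
  prod_map (fun i : 'I_n => X i) (fun i => T i).

Arguments partial_map X T n x : clear implicits.

(* Main.v *)
(* If perdim (X^(n), T^(n)) < d/2, generic continuous f : X^(n) -> R^d have an
   injective orbit map. Pairs of distinct points are sorted by their periods
   (truncated at some K large compared to dim X^(n)) and by whether they lie on
   a common orbit; each class is a countable union of compact sets, so by Baire
   it is enough to perturb f to separate small compact pieces of one class.
   Near points x, y of periods p <= q, outside a common orbit, f takes
   independent values along both orbits, and one perturbs to maps into the
   union of finitely many affine simplices in general position in R^(dq): the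
   dimensions are < dp/2 and < dq/2, so the images are disjoint. On a common
   orbit y = T^l x with l <= p/2, the itinerary of x in R^(dp) has to avoid the
   l-periodic sequences, which form a subspace of dimension dl <= dp/2.
   A continuous function on the full product is uniformly close to one that
   factors through some X^(n) with perdim < d/2, so a second application of
   Baire gives a function on X with injective orbit map. *)

Require Import Defs.
From mathcomp Require Import lra zify.

Set Implicit Arguments.
Unset Strict Implicit.
Unset Printing Implicit Defensive.

Import numFieldNormedType.Exports.

(** * Affine general position *)

Section GeneralPosition.
Local Open Scope ring_scope.
Variable R : realType.

(* Homogeneous coordinates: an affine subspace of R^D of dimension k is the
   row space of a matrix of rank k + 1. *)
Definition hrow D (v : 'rV[R]_D) : 'rV[R]_(1 + D) := row_mx 1%:M v.

(** The numbers [eps / i.+1%:R] for [i < size p] are pairwise distinct and too many to be all roots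
    of [p]. *)
Lemma nonroot_small (p : {poly R}) (eps : R) : p != 0 -> 0 < eps ->
  exists2 t, 0 < t <= eps & p.[t] != 0.
Proof.
move=> p0 e0; pose s := [seq eps / i.+1%:R | i <- iota 0 (size p)].
have us : uniq s.
  rewrite map_inj_uniq ?iota_uniq// => i j /(mulfI (lt0r_neq0 e0)) /invr_inj.
  by move/eqP; rewrite eqr_nat eqSS => /eqP.
have [sr|] := boolP (all (root p) s).
  by have := max_poly_roots p0 sr us; rewrite size_map size_iota ltnn.
case/allPn => _ /mapP[i _ ->] ni; exists (eps / i.+1%:R) => //.
by rewrite divr_gt0//= ler_pdivrMr// ler_peMr ?ler1n// ltW.
Qed.

(* Along the moment curve [v + (t, t^2, ..., t^D)] a nonzero affine functional
   is a nonzero polynomial in [t]. *)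
Lemma avoid_subspaces D (Ws : seq 'M[R]_(1 + D)) (v : 'rV[R]_D) (eps : R) :
  0 < eps -> (forall W, W \in Ws -> (\rank W <= D)%N) ->
  exists2 v' : 'rV[R]_D, (forall k, `|v' 0 k - v 0 k| <= eps) &
    forall W, W \in Ws -> ~~ (hrow v' <= W)%MS.
Proof.
move=> e0 rW.
pose vt (t : R) : 'rV[R]_D := \row_k (v 0 k + t ^+ k.+1).
have [p p0 Hp] : exists2 p : {poly R}, p != 0 &
    forall t, p.[t] != 0 -> forall W, W \in Ws -> ~~ (hrow (vt t) <= W)%MS.
  elim: Ws rW => [|W Ws IH] rW; first by exists 1; rewrite ?oner_neq0.
  have [|p p0 Hp] := IH.
    by move=> W' W's; apply: rW; rewrite inE W's orbT.
  have : cokermx W != 0.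
    by rewrite -mxrank_eq0 mxrank_coker -lt0n subn_gt0 ltnS rW ?inE ?eqxx.
  case/matrix0Pn => i0 [j0 nz].
  (* A nonzero column of the cokernel is an affine functional that vanishes on [W]; [q] below is its
     value along the curve. *)
  pose c : 'cV[R]_(1 + D) := col j0 (cokermx W).
  have Wc : W *m c = 0 by rewrite /c colE mulmxA mulmx_coker mul0mx.
  have c0 : c != 0 by apply/cV0Pn; exists i0; rewrite mxE.
  pose cu (k : 'I_D) := c (rshift 1 k) 0.
  pose q0 := c (lshift D 0) 0 + \sum_k v 0 k * cu k.
  pose q : {poly R} := q0%:P + \sum_k cu k *: 'X^(k.+1).
  have qE t : q.[t] = (hrow (vt t) *m c) 0 0.
    rewrite mxE big_split_ord /= big_ord1 /hrow row_mxEl mxE mul1r.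
    rewrite hornerD hornerC horner_sum /q0 -addrA -big_split/=; congr (_ + _).
    apply: eq_bigr => k _.
    by rewrite row_mxEr mxE hornerZ hornerXn mulrDl (mulrC (cu k)).
  have q_neq0 : q != 0.
    apply/eqP => q_eq0.
    have cu0 k : cu k = 0.
      have := congr1 (fun p : {poly R} => p`_k.+1) q_eq0.
      rewrite coefD coefC coef_sum coef0 add0r (bigD1 k)//=.
      rewrite coefZ coefXn eqxx mulr1.
      rewrite big1 ?addr0// => j jk; rewrite coefZ coefXn eqSS.
      by rewrite eq_sym (negPf (jk : (j : nat) != k)) mulr0.
    have q00 : q0 = 0.
      have := congr1 (fun p : {poly R} => p`_0) q_eq0.
      rewrite coefD coefC coef_sum coef0 big1 ?addr0// => j _.
      by rewrite coefZ coefXn mulr0.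
    move/eqP: c0; apply; apply/colP => i; rewrite [RHS]mxE.
    case: (split_ordP i) => j ->.
      rewrite (ord1 j); move: q00; rewrite /q0 big1 ?addr0// => k _.
      by rewrite cu0 mulr0.
    exact: cu0.
  exists (q * p); first by rewrite mulf_neq0.
  move=> t; rewrite hornerM mulf_eq0 => /norP[qt pt] W'.
  rewrite inE => /orP[/eqP->|]; last exact: Hp.
  apply/negP => /submxP[A hA]; move/eqP: qt; apply.
  by rewrite qE hA -mulmxA Wc mulmx0 mxE.
(* Capping [t] at 1 gives [t ^+ k.+1 <= t], so each coordinate moves by at most [eps]. *)
have e1 : 0 < Num.min eps 1 by rewrite lt_min e0 ltr01.
have [t /andP[t0 te] pt] := nonroot_small p0 e1.
exists (vt t); last exact: Hp.
move=> k; rewrite mxE addrC addKr.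
move: te; rewrite le_min => /andP[te t1].
have t0' := ltW t0.
rewrite ger0_norm ?exprn_ge0// exprS (le_trans _ te)//.
by rewrite ler_piMr// exprn_ile1.
Qed.

Lemma mxrank_sums_le D (I : finType) (S : {set I}) (u : I -> 'rV[R]_D) :
  (\rank (\sum_(i in S) <<u i>>)%MS <= #|S|)%N.
Proof.
rewrite -sum1_card; elim/big_rec2: _ => [|i n W _ IH]; first by rewrite mxrank0.
apply: leq_trans (mxrank_adds_leqif _ _) _.
by rewrite leq_add// genmxE rank_leq_row.
Qed.

(** The vertices are moved one after the other. Each new one avoids the sum of any [W] with the span
    of at most [n] vertices in their current positions, which has rank at most [r + n <= D]. *)
Lemma general_position D (I : finType) (Ws : seq 'M[R]_(1 + D)) (n r : nat)
    (v : I -> 'rV[R]_D) (eps : R) :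
  0 < eps -> (n + r <= D)%N -> (forall W, W \in Ws -> (\rank W <= r)%N) ->
  exists2 v' : I -> 'rV[R]_D, (forall i k, `|v' i 0 k - v i 0 k| <= eps) &
    forall W (a : I -> R), W \in Ws -> (#|[set i | a i != 0%R]| <= n.+1)%N ->
      ((\sum_i a i *: hrow (v' i))%R <= W)%MS -> forall i, a i = 0.
Proof.
move=> e0 nrD rW.
(* The induction runs over the vertices already placed, so supports are confined to those. *)
suff [v' v'v Hv'] : exists2 v' : I -> 'rV[R]_D,
    (forall i k, `|v' i 0 k - v i 0 k| <= eps) &
    forall W (a : I -> R), W \in Ws -> (#|[set i | a i != 0%R]| <= n.+1)%N ->
      (forall i, i \notin enum I -> a i = 0) ->
      ((\sum_i a i *: hrow (v' i))%R <= W)%MS -> forall i, a i = 0.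
  by exists v' => // W a Ww an; apply: Hv' => // i; rewrite mem_enum.
have := enum_uniq I; elim: (enum I) => [_|x s IH /= /andP[xs us]].
  exists v => [i k|W a _ _ a0 _ i]; first by rewrite subrr normr0 ltW.
  by rewrite a0.
have [v1 v1v Hv1] := IH us.
pose addW (W : 'M[R]_(1 + D)) (B : {set I}) :=
  (W + \sum_(i in B) <<hrow (v1 i)>>)%MS.
pose small : seq {set I} :=
  [seq B <- enum {: {set I}} | (#|B : {set I}| <= n)%N].
pose Us := [seq addW W B | W <- Ws, B <- small].
have rU U : U \in Us -> (\rank U <= D)%N.
  case/allpairsP => -[W B] [/= Ww]; rewrite mem_filter => /andP[Sn _] ->.
  apply: leq_trans (mxrank_adds_leqif _ _) _; apply: leq_trans nrD.
  by rewrite addnC leq_add ?rW// (leq_trans (mxrank_sums_le _ _)).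
have [u uv Hu] := avoid_subspaces (v x) e0 rU.
exists (fun i => if i == x then u else v1 i) => [i k|W a Ww an a0].
  by case: eqP => [->|].
have [ax0|ax0] := eqVneq (a x) 0.
  move=> h; apply: (Hv1 W) => //.
    move=> i is_; have [->//|ix] := eqVneq i x.
    by apply: a0; rewrite inE negb_or ix.
  congr (_ <= _)%MS: h; apply: eq_bigr => i _.
  by case: eqP => [->|//]; rewrite ax0 !scale0r.
rewrite (bigD1 x)//= eqxx => h; exfalso.
pose S := [set i | a i != 0] :\ x.
have Sn : (#|S| <= n)%N.
  by move: an; rewrite (cardsD1 x) inE ax0.
have /Hu/negP : (W + \sum_(i in S) <<hrow (v1 i)>>)%MS \in Us.
  by apply: allpairs_f => //; rewrite mem_filter Sn mem_enum.
(* As [a x] is nonzero, [hrow u] would lie in the sum of [W] with the at most [n] other vertices of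
   the support. *)
apply; rewrite /addW -(eqmx_scale (hrow u) ax0).
have sumS : ((\sum_(i | i != x) a i *: hrow (if i == x then u else v1 i))%R <=
    \sum_(i in S) <<hrow (v1 i)>>)%MS.
  apply: summx_sub => i ix; rewrite (negPf ix).
  have [->|ai] := eqVneq (a i) 0; first by rewrite scale0r sub0mx.
  apply: scalemx_sub; apply: submx_trans (sumsmx_sup i _ (submx_refl _)).
    by rewrite genmxE.
  by rewrite !inE ix.
rewrite -(addrK (\sum_(i | i != x) a i *: hrow (if i == x then u else v1 i))
  (a x *: _)).
rewrite addmx_sub ?(submx_trans h) ?addsmxSl//.
by rewrite eqmx_opp (submx_trans sumS) ?addsmxSr.
Qed.
End GeneralPosition.

Local Open Scope classical_set_scope.
Local Open Scope ring_scope.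

(** * Compact metric spaces *)

Section RealContinuity.
Variables (R : realType) (Y : topologicalType).
Implicit Types f g : Y -> R.

Lemma continuous_cst_fun (c : R) : continuous (fun _ : Y => c).
Proof. by move=> x; exact: cvg_cst. Qed.

Lemma continuous_add f g :
  continuous f -> continuous g -> continuous (fun x => f x + g x).
Proof. by move=> cf cg x; exact: (cvgD (cf x) (cg x)). Qed.

Lemma continuous_sub f g :
  continuous f -> continuous g -> continuous (fun x => f x - g x).
Proof. by move=> cf cg x; exact: (cvgB (cf x) (cg x)). Qed.

Lemma continuous_mul f g :
  continuous f -> continuous g -> continuous (fun x => f x * g x).
Proof. by move=> cf cg x; exact: (cvgM (cf x) (cg x)). Qed.

Lemma continuous_maxr f g :
  continuous f -> continuous g -> continuous (fun x => Num.max (f x) (g x)).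
Proof. by move=> cf cg x; exact: (@continuous_max R Y f g x (cf x) (cg x)). Qed.

Lemma continuous_inv f :
  (forall x, f x != 0) -> continuous f -> continuous (fun x => (f x)^-1).
Proof. by move=> f0 cf x; exact: (cvgV (f0 x) (cf x)). Qed.

Lemma continuous_sums (I : Type) (s : seq I) (P : pred I) (F : I -> Y -> R) :
  (forall i, P i -> continuous (F i)) ->
  continuous (fun x => \sum_(i <- s | P i) F i x).
Proof.
move=> cF; elim: s => [|i s IH].
  rewrite (_ : (fun _ => _) = fun=> 0); first exact: continuous_cst_fun.
  by apply/funext => x; rewrite big_nil.
have [Pi|nPi] := boolP (P i).
  rewrite (_ : (fun _ => _) = fun x => F i x + \sum_(j <- s | P j) F j x).
    exact: continuous_add (cF _ Pi) IH.
  by apply/funext => x; rewrite big_cons Pi.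
rewrite (_ : (fun _ => _) = fun x => \sum_(j <- s | P j) F j x)//.
by apply/funext => x; rewrite big_cons (negPf nPi).
Qed.

Lemma near_close f x (e : R) : continuous f -> 0 < e ->
  \forall y \near x, `|f x - f y| < e.
Proof. by move=> cf e0; have /cvgrPdist_lt := cf x; exact. Qed.
End RealContinuity.

Lemma near_right0_ex (R : realType) (P : R -> Prop) :
  (\forall r \near 0^'+, P r) -> exists2 r, 0 < r & P r.
Proof.
move=> h; near (0 : R)^'+ => r; exists r; last by near: r.
by near: r; exact: nbhs_right_gt.
Unshelve. all: by end_near. Qed.

(* Finite products of metric spaces carry the product topology but no
   [metricType] structure, hence metrics given as plain functions. *)
Record compatible_metric (R : realType) (Y : topologicalType)
    (rho : Y -> Y -> R) : Prop := CompatibleMetric {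
  cm_ge0 : forall x y, 0 <= rho x y;
  cm_xx : forall x, rho x x = 0;
  cm_eq : forall x y, rho x y = 0 -> x = y;
  cm_sym : forall x y, rho x y = rho y x;
  cm_triangle : forall x y z, rho x z <= rho x y + rho y z;
  cm_continuous : forall x, continuous (rho x) }.

Arguments cm_continuous {R Y rho} _ x.

Section CompactMetric.
Variables (R : realType) (Y : topologicalType) (rho : Y -> Y -> R).
Hypothesis cm : compatible_metric rho.
Hypothesis cY : compact [set: Y].

Lemma cm_gt0 x y : x != y -> 0 < rho x y.
Proof.
move=> xy; rewrite lt_neqAle (cm_ge0 cm) andbT eq_sym.
by apply: contra xy => /eqP/(cm_eq cm) ->.
Qed.

Lemma cm_near x (e : R) : 0 < e -> \forall y \near x, rho x y < e.
Proof.
move=> e0; have := near_close x (cm_continuous cm x) e0; apply: filterS => y.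
by rewrite (cm_xx cm) sub0r normrN ger0_norm// (cm_ge0 cm).
Qed.

(** Compatibility only makes balls open. That they form a base of neighbourhoods comes from
    compactness: on the complement of [U] the distance to [x] is bounded away from 0. *)
Lemma ball_in_open (U : set Y) x : open U -> U x ->
  exists2 e, 0 < e & forall y, rho x y < e -> U y.
Proof.
move=> oU Ux.
have /compact_near_coveringP cK : compact (~` U).
  by apply: (@subclosed_compact _ _ setT) => //; rewrite closedC.
have /near_right0_ex[] : \forall r \near 0^'+, ~` U `<=` (fun y => r < rho x y).
  apply: cK => y Uy.
  have xy0 : 0 < rho x y / 2.
    by rewrite divr_gt0// cm_gt0//; apply/eqP => xy; apply: Uy; rewrite -xy.
  near=> y' r => /=; have : r < rho x y / 2 by near: r; exact: nbhs_right_lt.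
  have : rho y y' < rho x y / 2 by near: y'; exact: cm_near.
  have := cm_triangle cm x y' y; rewrite (cm_sym cm y' y); lra.
move=> r r0 Hr; exists r => // y xy; apply: contrapT => Uy.
by have := Hr y Uy; rewrite /= ltNge (ltW xy).
Unshelve. all: by end_near. Qed.

Lemma ball_in_nbhs (A : set Y) x : nbhs x A ->
  exists2 e, 0 < e & forall y, rho x y < e -> A y.
Proof.
move=> Ax; have [e e0 He] := @ball_in_open (interior A) x (open_interior A) Ax.
by exists e => // y /He; exact: interior_subset.
Qed.

Lemma open_cm_ball x r : open [set y | rho x y < r].
Proof.
have /continuousP/(_ [set t | t < r]) := cm_continuous cm x.
by apply; exact: open_lt.
Qed.

Lemma uniformly_continuous_family (E : finType) (F : E -> Y -> R) (eps : R) :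
  (forall e, continuous (F e)) -> 0 < eps ->
  exists2 r, 0 < r &
    forall x y, rho x y < r -> forall e, `|F e x - F e y| <= eps.
Proof.
move=> cF e0; have e20 : 0 < eps / 2 by rewrite divr_gt0.
move/compact_near_coveringP: cY => cY'.
have /near_right0_ex[r r0 Hr] : \forall r \near 0^'+, [set: Y] `<=`
    (fun x => forall y, rho x y < r -> forall e, `|F e x - F e y| <= eps).
  apply: (cY' _ _ (fun r x => forall y, rho x y < r ->
    forall e, `|F e x - F e y| <= eps)) => x _.
  have /ball_in_nbhs[q q0 Hq] : \forall y \near x,
      forall e, `|F e x - F e y| < eps / 2.
    by apply: filter_forall => e; exact: near_close.
  have q20 : 0 < q / 2 by rewrite divr_gt0.
  near=> x' r => /= y x'y e.
  have rq : r < q / 2 by near: r; exact: nbhs_right_lt.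
  have xx' : rho x x' < q / 2 by near: x'; exact: cm_near.
  have xy : rho x y < q by have := cm_triangle cm x x' y; lra.
  have xx'q : rho x x' < q by lra.
  have := Hq _ xy e; have := Hq _ xx'q e; rewrite !ltr_norml ler_norml.
  by move=> /andP[? ?] /andP[? ?]; apply/andP; split; lra.
by exists r => // x y; exact: Hr.
Unshelve. all: by end_near. Qed.

Lemma lebesgue_number (I : Type) (Z : set Y) (U : I -> set Y) :
  closed Z -> (forall i, open (U i)) -> Z `<=` \bigcup_i U i ->
  exists2 r, 0 < r & forall z, Z z -> exists i, forall y, rho z y < r -> U i y.
Proof.
move=> clZ oU ZU.
have /compact_near_coveringP cZ : compact Z.
  exact: (@subclosed_compact _ _ setT).
have /near_right0_ex[] : \forall r \near 0^'+,
    Z `<=` (fun z => exists i, forall y, rho z y < r -> U i y).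
  apply: cZ => z /ZU[i _ Uz].
  have [e e0 He] := ball_in_open (oU i) Uz.
  have e20 : 0 < e / 2 by rewrite divr_gt0.
  near=> z' r => /=; exists i => y zy; apply: He.
  have : r < e / 2 by near: r; exact: nbhs_right_lt.
  have : rho z z' < e / 2 by near: z'; exact: cm_near.
  have := cm_triangle cm z z' y; lra.
by move=> r r0 Hr; exists r.
Unshelve. all: by end_near. Qed.

Lemma finite_net (r : R) : 0 < r ->
  exists s : seq Y, forall y, exists2 z, z \in s & rho z y < r.
Proof.
move=> r0; have /compact_near_coveringP cY' := cY.
(* Finite lists directed by inclusion: compactness along this filter turns the local choices
   [[:: x]] into a single finite list. *)
pose F : set_system (seq Y) :=
  [set A | exists s : seq Y, forall t : seq Y, {subset s <= t} -> A t].
have FF : Filter F.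
  split; first by exists [::].
    move=> A B [s sA] [t tB]; exists (s ++ t) => u stu; split.
      by apply: sA => x xs; apply: stu; rewrite mem_cat xs.
    by apply: tB => x xs; apply: stu; rewrite mem_cat xs orbT.
  by move=> A B AB [s sA]; exists s => t /sA /AB.
have [s Hs] : F (fun s => [set: Y] `<=`
    (fun y => exists2 z, z \in s & rho z y < r)).
  apply: (cY' _ F (fun s y => exists2 z, z \in s & rho z y < r)) => x _.
  exists ([set y | rho x y < r], [set s | x \in s]) => /=.
    split; first exact: cm_near.
    by exists [:: x] => t; apply; rewrite inE.
  by move=> [y s] /= [xy xs]; exists x.
by exists s => y; apply: (Hs s).
Qed.

(** Distance bumps at the points of a finite net are grouped by a set of the cover that contains
    their support, then normalized. *)
Lemma partition_of_unity (I : finType) (Z : set Y) (U : I -> set Y) :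
  closed Z -> (forall i, open (U i)) -> Z `<=` \bigcup_i U i ->
  exists la : I -> Y -> R,
    [/\ forall i, continuous (la i), forall i y, 0 <= la i y,
        forall i y, la i y != 0 -> U i y,
        forall y, \sum_i la i y <= 1 &
        forall z, Z z -> \sum_i la i z = 1].
Proof.
move=> clZ oU ZU; have [r r0 Hr] := lebesgue_number clZ oU ZU.
have r20 : 0 < r / 2 by rewrite divr_gt0.
have r40 : 0 < r / 2 / 2 by rewrite divr_gt0.
have [s Hs] := finite_net r40.
(* Net points far from [Z] may have no such set; their bumps are dropped. *)
pose phi z := [pick i | `[< forall y, rho z y < r / 2 -> U i y >]].
pose bump z y := Num.max 0 (r / 2 - rho z y).
pose mu i y := \sum_(z <- s | phi z == Some i) bump z y.
have bump0 z y : 0 <= bump z y by rewrite le_max lexx.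
have mu0 i y : 0 <= mu i y by apply: sumr_ge0.
(* The lower bound keeps the quotients continuous off [Z]. A point of [Z] is within [r / 2 / 2] of a
   net point whose bump there is at least [r / 2 / 2], so on [Z] the denominator is the sum
   itself. *)
pose den y := Num.max (r / 2 / 2) (\sum_i mu i y).
have den0 y : 0 < den y by rewrite lt_max r40.
have cbump z : continuous (bump z).
  apply: continuous_maxr; first exact: continuous_cst_fun.
  by apply: continuous_sub (cm_continuous cm z); exact: continuous_cst_fun.
have cmu i : continuous (mu i) by exact: continuous_sums.
have cden : continuous den.
  apply: continuous_maxr; first exact: continuous_cst_fun.
  exact: continuous_sums.
exists (fun i y => mu i y / den y); split.
- move=> i; apply: continuous_mul => //.
  by apply: continuous_inv cden => x; rewrite gt_eqF.
- by move=> i y; rewrite divr_ge0// ltW.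
- move=> i y; rewrite mulf_eq0 negb_or => /andP[+ _].
  apply: contraNP => Uy; rewrite /mu big1_seq// => z /andP[/eqP + _].
  rewrite /phi; case: pickP => // j /asboolP Hj [ji]; rewrite {}ji in Hj.
  apply/max_idPl; rewrite subr_le0 leNgt.
  by apply/negP => /Hj.
- move=> y; rewrite -mulr_suml ler_pdivrMr// mul1r.
  by rewrite le_max lexx orbT.
- move=> z Zz; rewrite -mulr_suml.
  suff <- : den z = \sum_i mu i z by rewrite divff// gt_eqF.
  apply/max_idPr; have [w ws wz] := Hs z; have [i Hi] := Hr z Zz.
  have [j phiw] : exists j, phi w = Some j.
    rewrite /phi; case: pickP => [j _|/(_ i)]; first by exists j.
    move/asboolP => h; case: h => y wy; apply: Hi.
    by have := cm_triangle cm z w y; rewrite (cm_sym cm z w); lra.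
  rewrite (bigD1 j)//= /mu (big_rem w)//= phiw eqxx -addrA.
  apply: (@le_trans _ _ (bump w z)).
    by rewrite le_max; apply/orP; right; lra.
  by rewrite lerDl addr_ge0// sumr_ge0// => k _; exact: mu0.
Qed.
End CompactMetric.

(** * Maps into polyhedra in general position *)

(* Here V j is a subset of U (phi j) even outside Z, so that functions defined
   from a partition of unity on Z can be controlled on all of Y. *)
Definition dim_le (Y : topologicalType) (Z : set Y) (n : nat) :=
  forall (I : finType) (U : I -> set Y), (forall i, open (U i)) ->
    Z `<=` \bigcup_i U i ->
  exists (J : finType) (V : J -> set Y) (phi : J -> I),
    [/\ forall j, open (V j), Z `<=` \bigcup_j V j,
        forall j, V j `<=` U (phi j) &
        forall z, Z z -> (#|[pred j | `[< V j z >]]| <= n.+1)%N].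

Section Coordinates.
Variables (R : realType).

Definition hvec (E : finType) (v : E -> R) : 'rV[R]_(1 + #|E|) :=
  hrow (\row_k v (enum_val k)).

(** Right multiplication pulls a family back along [pi]. It carries polyhedra of short itineraries
    to polyhedra of longer periodic ones, and its row space describes the families that factor
    through [pi]. *)
Definition reindex_mx (E E' : finType) (pi : E' -> E) :
    'M[R]_(1 + #|E|, 1 + #|E'|) :=
  block_mx 1%:M 0 0 (\matrix_(k, l) (enum_val k == pi (enum_val l))%:R).

Lemma hvec_reindex (E E' : finType) (pi : E' -> E) (v : E -> R) :
  hvec v *m reindex_mx pi = hvec (v \o pi).
Proof.
rewrite /hvec /hrow mul_row_block mulmx1 !mulmx0 addr0 add0r; congr row_mx.
apply/rowP => l; rewrite !mxE (bigD1 (enum_rank (pi (enum_val l))))//=.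
rewrite !mxE enum_rankK eqxx mulr1 big1 ?addr0// => k kl; rewrite !mxE.
rewrite (_ : _ == _ = false) ?mulr0//; apply: contra_neqF kl => /eqP <-.
by rewrite enum_valK.
Qed.
End Coordinates.

Section Approximation.
Variables (R : realType) (Y : topologicalType) (rho : Y -> Y -> R).
Hypothesis cm : compatible_metric rho.
Hypothesis cY : compact [set: Y].

Lemma small_cover (E : finType) (F : E -> Y -> R) (eps : R) :
  (forall e, continuous (F e)) -> 0 < eps ->
  exists (I : finType) (U : I -> set Y) (p : I -> Y),
    [/\ forall i, open (U i), [set: Y] `<=` \bigcup_i U i &
        forall i e y, U i y -> `|F e (p i) - F e y| <= eps].
Proof.
move=> cF e0; have [r r0 Hr] := uniformly_continuous_family cm cY cF e0.
have [s Hs] := finite_net cm cY r0.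
exists 'I_(size s), (fun i y => rho (tnth (in_tuple s) i) y < r),
  (tnth (in_tuple s)).
split=> [i|y _|i e y /Hr//].
  exact: open_cm_ball.
have [z zs zy] := Hs y; have zi : (index z s < size s)%N by rewrite index_mem.
by exists (Ordinal zi) => //=; rewrite (tnth_nth z)/= nth_index.
Qed.

(* The perturbed map is the barycentric map of the nerve of a fine cover, with
   vertices in general position. *)
Lemma approx_general_position (Z : set Y) (n r : nat) (E : finType)
    (F : E -> Y -> R) (Ws : seq 'M[R]_(1 + #|E|)) (eps : R) :
  closed Z -> dim_le Z n -> (forall e, continuous (F e)) -> 0 < eps ->
  (n + r <= #|E|)%N -> (forall W, W \in Ws -> (\rank W <= r)%N) ->
  exists (F' : E -> Y -> R) (Ms : seq 'M[R]_(1 + #|E|)),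
    [/\ forall e, continuous (F' e),
        forall e y, `|F' e y - F e y| <= eps,
        forall M, M \in Ms -> (\rank M <= n.+1)%N,
        forall z, Z z -> exists2 M, M \in Ms & (hvec (F' ^~ z) <= M)%MS &
        forall z W, Z z -> W \in Ws -> ~~ (hvec (F' ^~ z) <= W)%MS].
Proof.
move=> clZ dZ cF e0 nrE rW; have e20 : 0 < eps / 2 by rewrite divr_gt0.
have [I [U [p [oU YU Up]]]] := small_cover cF e20.
have [J [V [phi [oV ZV VU Vn]]]] := dZ I U oU (subset_trans (@subsetT _ Z) YU).
have [la [cla la0 laV la1 laZ]] := partition_of_unity cm cY clZ oV ZV.
pose v j : 'rV[R]_#|E| := \row_k F (enum_val k) (p (phi j)).
have [v' v'v Hv'] := general_position v e20 nrE rW.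
pose vE j e := v' j 0 (enum_rank e).
have vEF j e y : V j y -> `|vE j e - F e y| <= eps.
  move=> Vy; have := v'v j (enum_rank e); rewrite mxE enum_rankK -/(vE j e).
  have := Up _ e _ (VU _ _ Vy); rewrite !ler_norml.
  by move=> /andP[? ?] /andP[? ?]; apply/andP; split; lra.
(* Written as a correction of [F], so that the map stays close to [F] off [Z], where the weights may
   sum to less than 1; on [Z] it is the barycentric map. *)
pose F' e y := F e y + \sum_j la j y * (vE j e - F e y).
have F'Z e z : Z z -> F' e z = \sum_j la j z * vE j e.
  move=> Zz; rewrite /F' (eq_bigr _ (fun j _ => mulrBr _ _ _)) sumrB -mulr_suml.
  by rewrite laZ// mul1r addrC subrK.
have hF' z : Z z -> hvec (F' ^~ z) = \sum_j la j z *: hrow (v' j).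
  move=> Zz; apply/rowP => k; rewrite summxE /hvec /hrow.
  case: (split_ordP k) => l ->.
    rewrite row_mxEl (ord1 l) mxE eqxx mulr1n -[LHS](laZ z Zz).
    by apply: eq_bigr => j _; rewrite mxE row_mxEl mxE eqxx mulr1.
  rewrite row_mxEr mxE F'Z//; apply: eq_bigr => j _.
  by rewrite mxE row_mxEr /vE enum_valK.
have suppV z : Z z -> (#|[set j | la j z != 0%R]%SET| <= n.+1)%N.
  move=> Zz; apply: leq_trans (Vn _ Zz); apply: subset_leq_card.
  by apply/fintype.subsetP => j; rewrite !inE => /laV.
pose spanv (B : {set J}) := (\sum_(j in B) <<hrow (v' j)>>)%MS.
pose Ms := [seq spanv B |
  B <- [seq B <- enum {: {set J}} | (#|B : {set J}| <= n.+1)%N]].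
exists F', Ms; split.
- move=> e; apply: continuous_add => //; apply: continuous_sums => j _.
  apply: continuous_mul => //; apply: continuous_sub => //.
  exact: continuous_cst_fun.
- move=> e y; rewrite /F' addrC addKr; apply: le_trans (ler_norm_sum _ _ _) _.
  apply: (@le_trans _ _ (\sum_j la j y * eps)); last first.
    by rewrite -mulr_suml ler_piMl// ltW.
  apply: ler_sum => j _; rewrite normrM (ger0_norm (la0 _ _)).
  have [->|/laV/vEF h] := eqVneq (la j y) 0; first by rewrite !mul0r.
  exact: ler_wpM2l.
- move=> M /mapP[B]; rewrite mem_filter => /andP[Bn _] ->.
  exact: leq_trans (mxrank_sums_le _ _) Bn.
- move=> z Zz; pose B := [set j | la j z != 0%R]%SET; exists (spanv B).
    by apply: map_f; rewrite mem_filter suppV// mem_enum.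
  rewrite hF'//; apply: summx_sub => j _.
  have [->|laj] := eqVneq (la j z) 0; first by rewrite scale0r sub0mx.
  apply: scalemx_sub; apply: submx_trans (sumsmx_sup j _ (submx_refl _)).
    by rewrite genmxE.
  by rewrite !inE.
(* Membership in [W] would force all weights to vanish, but they sum to 1 on [Z]. *)
- move=> z W Zz Ww; rewrite hF'//.
  apply/negP => /(Hv' W _ Ww (suppV _ Zz)) la_eq0.
  have := laZ z Zz; rewrite big1 => [/eqP|j _]; last exact: la_eq0.
  by rewrite eq_sym oner_eq0.
Qed.

(** A partition of unity subordinate to the complements [O j] of the other closed sets averages the
    [G j]; on [C j] only the weight of [j] survives. The index [j0] serves the points outside all
    [C j]. *)
Lemma glue (J : finType) (C : J -> set Y) (D : Type) (f : D -> Y -> R)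
    (G : J -> D -> Y -> R) (eps : R) (j0 : J) :
  (forall j, closed (C j)) ->
  (forall i j y, C i y -> C j y -> i = j) ->
  (forall j c, continuous (G j c)) ->
  (forall j c y, `|G j c y - f c y| <= eps) ->
  exists f' : D -> Y -> R, [/\ forall c, continuous (f' c),
    forall c y, `|f' c y - f c y| <= eps &
    forall j c y, C j y -> f' c y = G j c y].
Proof.
move=> clC dC cG Gf.
pose O j := ~` (\bigcup_(i in [set i | i != j]) C i).
have OP j y : O j y <-> forall i, i != j -> ~ C i y.
  split=> [Oy i ij Ciy|Oy [i /= ij Ciy]]; last exact: (Oy i).
  by apply: Oy; exists i.
have oO j : open (O j).
  rewrite openC; apply: closed_bigcup => [|i _]; last exact: clC.
  exact: finite_finset.
have cover_O : [set: Y] `<=` \bigcup_j O j.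
  move=> y _; have [[j Cjy]|nC] := pselect (exists j, C j y).
    exists j => //; apply/OP => i + Ciy; rewrite (dC i j y)// eqxx//.
  by exists j0 => //; apply/OP => i _ Ciy; apply: nC; exists i.
have [la [cla la0 laO _ la1]] :=
  partition_of_unity cm cY (@closedT _) oO cover_O.
exists (fun c y => \sum_j la j y * G j c y); split.
- by move=> c; apply: continuous_sums => j _; exact: continuous_mul.
- move=> c y; rewrite -[f c y]mul1r -(la1 y)// mulr_suml -sumrB.
  apply: le_trans (ler_norm_sum _ _ _) _.
  rewrite -[leRHS]mul1r -(la1 y)// mulr_suml; apply: ler_sum => j _.
  by rewrite -mulrBr normrM (ger0_norm (la0 _ _)) ler_wpM2l.
- move=> j c y Cjy.
  have la_eq0 i : i != j -> la i y = 0.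
    move=> ij; apply/eqP; apply: contraPT Cjy => /laO/OP; apply.
    by rewrite eq_sym.
  rewrite (bigD1 j)//= big1 ?addr0; last by move=> i ij; rewrite la_eq0 ?mul0r.
  have := la1 y Logic.I; rewrite (bigD1 j)//= big1 ?addr0 => [->|i ij].
    by rewrite mul1r.
  exact: la_eq0.
Qed.
End Approximation.

(** Only forward times are allowed, which is stronger than separation by two-sided itineraries. *)
Definition orbit_separated (R : realType) (D : Type) (Y : Type) (T : Y -> Y)
    (f : D -> Y -> R) (x y : Y) :=
  exists k c, f c (iter k T x) <> f c (iter k T y).

Lemma iterK (Y : Type) (h h' : Y -> Y) k :
  cancel h h' -> cancel (iter k h) (iter k h').
Proof. by move=> hK; elim: k => // k IH x; rewrite iterSr /= hK IH. Qed.

Lemma iter_inj (Y : Type) (h h' : Y -> Y) k :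
  cancel h h' -> injective (iter k h).
Proof. by move=> hK; exact: can_inj (iterK k hK). Qed.

(** * Prescribing itineraries on pieces with disjoint iterates *)

Section Separation.
Variables (R : realType) (Y : topologicalType) (rho : Y -> Y -> R).
Hypothesis cm : compatible_metric rho.
Hypothesis cY : compact [set: Y].
Variables (T g : Y -> Y).
Hypotheses (cT : continuous T) (cg : continuous g).
Hypotheses (gK : cancel g T) (Tg : cancel T g).

Lemma continuous_iter (h : Y -> Y) k : continuous h -> continuous (iter k h).
Proof.
move=> ch; elim: k => [|k IH] x; first exact: cvg_id.
exact: (continuous_comp (IH x) (ch _)).
Qed.

Variable d : nat.
Implicit Type f : 'I_d -> Y -> R.

Definition itinerary t f (e : 'I_t * 'I_d) (y : Y) := f e.2 (iter e.1 T y).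

Lemma continuous_itinerary t f e :
  (forall c, continuous (f c)) -> continuous (@itinerary t f e).
Proof.
by move=> cf x; apply: continuous_comp; [exact: continuous_iter|exact: cf].
Qed.

(** The function to be prescribed on the [i]-th iterate of a piece, so that the itinerary of a point
    of the piece becomes its value under [F]. *)
Definition transported t (F : 'I_t * 'I_d -> Y -> R) (i : 'I_t) (c : 'I_d) y :=
  F (i, c) (iter i g y).

Lemma continuous_transported t (F : 'I_t * 'I_d -> Y -> R) i c :
  (forall e, continuous (F e)) -> continuous (transported F i c).
Proof.
by move=> cF x; apply: continuous_comp; [exact: continuous_iter|exact: cF].
Qed.

Lemma transported_close t f (F : 'I_t * 'I_d -> Y -> R) eps i c y :
  (forall e y, `|F e y - itinerary f e y| <= eps) ->
  `|transported F i c y - f c y| <= eps.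
Proof.
move=> Ff; have := Ff (i, c) (iter i g y).
by rewrite /itinerary/= (iterK _ gK).
Qed.

(* General position of two polyhedra of dimensions nA and nB in R^(t * d). When
   s < t the points of A have period s and their itineraries of length t are
   determined by the first s terms. *)
Lemma separate_disjoint (s t nA nB : nat) (A B ZA ZB : set Y) f (eps : R) :
  closed A -> closed B -> closed ZA -> closed ZB -> A `<=` ZA -> B `<=` ZB ->
  dim_le ZA nA -> dim_le ZB nB -> (0 < s <= t)%N ->
  (nA <= s * d)%N -> (nA + nB < t * d)%N ->
  (forall i j a a', (i < s)%N -> (j < s)%N -> A a -> A a' ->
     iter i T a = iter j T a' -> i = j) ->
  (forall i j b b', (i < t)%N -> (j < t)%N -> B b -> B b' ->
     iter i T b = iter j T b' -> i = j) ->
  (forall i j a b, (i < s)%N -> (j < t)%N -> A a -> B b ->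
     iter i T a <> iter j T b) ->
  (forall i a, (i < t)%N -> A a -> iter i T a = iter (i %% s) T a) ->
  (forall c, continuous (f c)) -> 0 < eps ->
  exists f', [/\ forall c, continuous (f' c),
    forall c y, `|f' c y - f c y| <= eps &
    forall a b, A a -> B b -> orbit_separated T f' a b].
Proof.
move=> clA clB clZA clZB AZ BZ dA dB /andP[s0 st] nAs nABt.
move=> disA disB disAB perA cf e0.
have t0 : (0 < t)%N by case: t {st dA dB disB disAB perA} nABt.
have [FA [Ms [cFA FAf rMs MsA _]]] := @approx_general_position R Y rho cm cY
  ZA nA 0 ('I_s * 'I_d)%type (itinerary f) [::] eps clZA dA
  (fun e => continuous_itinerary (e := e) cf) e0
  ltac:(by rewrite addn0 card_prod !card_ord) (fun _ => ltac:(done)).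
(* Reducing time modulo [s] extends itineraries of [A] to length [t]. [Ws] is the polyhedron of [A]
   carried into dimension [t * d], and [FB] is then chosen to miss it. *)
pose pi (e : 'I_t * 'I_d) : 'I_s * 'I_d := (Ordinal (ltn_pmod e.1 s0), e.2).
pose Ws := [seq (<< M *m reindex_mx R pi>>)%MS | M <- Ms].
have rW W : W \in Ws -> (\rank W <= nA.+1)%N.
  case/mapP => M /rMs rM ->; rewrite genmxE.
  exact: leq_trans (mxrankM_maxl _ _) rM.
have [FB [_ [cFB FBf _ _ FBW]]] := @approx_general_position R Y rho cm cY
  ZB nB nA.+1 ('I_t * 'I_d)%type (itinerary f) Ws eps clZB dB
  (fun e => continuous_itinerary (e := e) cf) e0
  ltac:(rewrite card_prod !card_ord; lia) rW.
(* These are the iterates of [A] and of [B]. They are disjoint, so one function can realize both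
   [FA] and [FB]. *)
pose C (j : 'I_s + 'I_t) := match j with
  | inl i => iter i g @^-1` A | inr i => iter i g @^-1` B end.
pose G (j : 'I_s + 'I_t) := match j with
  | inl i => transported FA i | inr i => transported FB i end.
have CE (h : nat) y : iter h T (iter h g y) = y by exact: iterK.
have [||||f' [cf' f'f f'G]] := @glue R Y rho cm cY ('I_s + 'I_t)%type C 'I_d
  f G eps (inl (Ordinal s0)).
- move=> [] i; apply: closed_comp => // x _; exact: continuous_iter.
- move=> [i|i] [j|j] y /= Ci Cj.
  + congr inl; apply/val_inj => /=.
    by apply: (disA _ _ (iter i g y) (iter j g y)) => //; rewrite !CE.
  + by case: (disAB i j (iter i g y) (iter j g y)) => //; rewrite !CE.
  + by case: (disAB j i (iter j g y) (iter i g y)) => //; rewrite !CE.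
  + congr inr; apply/val_inj => /=.
    by apply: (disB _ _ (iter i g y) (iter j g y)) => //; rewrite !CE.
- by move=> [i|i] c; exact: continuous_transported.
- by move=> [i|i] c y; exact: transported_close.
exists f'; split=> // a b Aa Bb; apply: contrapT => nsep.
have eqf i c : f' c (iter i T a) = f' c (iter i T b).
  by apply: contrapT => ne; apply: nsep; exists i, c.
have Ea (i : 'I_s) c : f' c (iter i T a) = FA (i, c) a.
  have Cj : C (inl i) (iter i T a) by rewrite /C /= (iterK _ Tg).
  by rewrite (f'G _ c _ Cj) /G /transported (iterK _ Tg).
have Eb (i : 'I_t) c : f' c (iter i T b) = FB (i, c) b.
  have Cj : C (inr i) (iter i T b) by rewrite /C /= (iterK _ Tg).
  by rewrite (f'G _ c _ Cj) /G /transported (iterK _ Tg).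
have EAB : FB ^~ b = (FA ^~ a) \o pi.
  apply/funext => -[i c] /=; rewrite -Eb -Ea /= -eqf perA//.
have [M Mm hM] := MsA a (AZ _ Aa).
have /negP := FBW b _ (BZ _ Bb)
  (map_f (fun M => << M *m reindex_mx R pi>>%MS) Mm).
by apply; rewrite EAB -hvec_reindex genmxE submxMr.
Qed.

(* If all [f' (T^i a)] equal [f' (T^(i+l) a)], the itinerary of [a] lies in the
   subspace of [l]-periodic sequences. *)
Lemma separate_shifted (t l n : nat) (A Z : set Y) f (eps : R) :
  closed A -> closed Z -> A `<=` Z -> dim_le Z n -> (0 < l < t)%N ->
  (n + l * d < t * d)%N ->
  (forall i j a a', (i < t)%N -> (j < t)%N -> A a -> A a' ->
     iter i T a = iter j T a' -> i = j) ->
  (forall c, continuous (f c)) -> 0 < eps ->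
  exists f', [/\ forall c, continuous (f' c),
    forall c y, `|f' c y - f c y| <= eps &
    forall a, A a -> orbit_separated T f' a (iter l T a)].
Proof.
move=> clA clZ AZ dZ /andP[l0 lt] nlt disA cf e0.
have t0 : (0 < t)%N by exact: leq_trans lt.
pose pi (e : 'I_t * 'I_d) : 'I_l * 'I_d := (Ordinal (ltn_pmod e.1 l0), e.2).
(* The matrix has [1 + l * d] rows, one for each free value of an [l]-periodic sequence and one for
   the homogeneous coordinate. *)
have rW W : W \in [:: <<reindex_mx R pi>>%MS] -> (\rank W <= 1 + l * d)%N.
  rewrite inE => /eqP ->; rewrite genmxE; apply: leq_trans (rank_leq_row _) _.
  by rewrite card_prod !card_ord.
have [F [_ [cF Ff _ _ FW]]] := @approx_general_position R Y rho cm cY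
  Z n (1 + l * d) ('I_t * 'I_d)%type (itinerary f) _ eps clZ dZ
  (fun e => continuous_itinerary (e := e) cf) e0
  ltac:(rewrite card_prod !card_ord; lia) rW.
pose C (i : 'I_t) := iter i g @^-1` A.
have CE (h : nat) y : iter h T (iter h g y) = y by exact: iterK.
have [||||f' [cf' f'f f'G]] := @glue R Y rho cm cY 'I_t C 'I_d f
  (transported F) eps (Ordinal t0).
- move=> i; apply: closed_comp => // x _; exact: continuous_iter.
- move=> i j y /= Ci Cj; apply/val_inj => /=.
  by apply: (disA _ _ (iter i g y) (iter j g y)) => //; rewrite !CE.
- by move=> i c; exact: continuous_transported.
- by move=> i c y; exact: transported_close.
exists f'; split=> // a Aa; apply: contrapT => nsep.
have eqf i c : f' c (iter i T a) = f' c (iter (i + l) T a).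
  by rewrite iterD; apply: contrapT => ne; apply: nsep; exists i, c.
have Ea (i : 'I_t) c : f' c (iter i T a) = F (i, c) a.
  have Cj : C i (iter i T a) by rewrite /C /= (iterK _ Tg).
  by rewrite (f'G _ c _ Cj) /transported (iterK _ Tg).
have modl k c : f' c (iter k T a) = f' c (iter (k %% l)%N T a).
  rewrite {1}(divn_eq k l) addnC.
  elim: (k %/ l)%N => [|m IH]; first by rewrite addn0.
  by rewrite mulSnr addnA -eqf.
have EF : F ^~ a = (fun e : 'I_l * 'I_d => f' e.2 (iter e.1 T a)) \o pi.
  by apply/funext => -[i c] /=; rewrite -Ea modl.
have /negP := FW a _ (AZ _ Aa) (mem_head _ _).
by apply; rewrite EF -hvec_reindex genmxE submxMl.
Qed.
End Separation.

(** * Separation of orbits *)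

Definition uniformly_close (R : realType) (D Y : Type) (eps : R)
    (f g : D -> Y -> R) := forall c y, `|g c y - f c y| <= eps.

Section Baire.
Variables (R : realType) (Y : topologicalType) (D : Type).
Implicit Types f g h : D -> Y -> R.

Definition continuous_family f := forall c, continuous (f c).

(** A pair is separated at a single time [k], hence so are nearby pairs under nearby families;
    compactness of [K] makes the tolerance uniform. *)
Lemma orbit_separated_stable (T : Y -> Y) (K : set (Y * Y)) f :
  continuous T -> compact K -> continuous_family f ->
  (forall x y, K (x, y) -> orbit_separated T f x y) ->
  exists2 e : R, 0 < e & forall h, uniformly_close e f h ->
    forall x y, K (x, y) -> orbit_separated T h x y.
Proof.
move=> cT /compact_near_coveringP cK cf sf.
pose P (e : R) (p : Y * Y) := forall h, uniformly_close e f h ->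
  orbit_separated T h p.1 p.2.
have /near_right0_ex[e e0 He] : \forall e \near 0^'+, K `<=` P e.
  apply: cK => -[x y] Kxy; have [k [c fxy]] := sf x y Kxy.
  have cfT : continuous (fun z => f c (iter k T z)).
    by move=> z; apply: continuous_comp; [exact: continuous_iter|exact: cf].
  (* A quarter of the gap: moving the two points and replacing [f] by [h] at both of them cost less
     than [q] each. *)
  pose q := `|f c (iter k T x) - f c (iter k T y)| / 4.
  have q0 : 0 < q by rewrite divr_gt0// normr_gt0 subr_eq0; apply/eqP.
  have qE : `|f c (iter k T x) - f c (iter k T y)| = q * 4 by rewrite divfK.
  have nearx := near_close x cfT q0; have neary := near_close y cfT q0.
  exists (([set x' | `|f c (iter k T x) - f c (iter k T x')| < q] `*`
           [set y' | `|f c (iter k T y) - f c (iter k T y')| < q]),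
          [set e | e < q]) => /=.
    split; last exact: nbhs_right_lt.
    by exists ([set x' | `|f c (iter k T x) - f c (iter k T x')| < q],
               [set y' | `|f c (iter k T y) - f c (iter k T y')| < q]).
  move=> [[x' y'] e] /= [[xx' yy'] eq] h hf; exists k, c => hxy.
  have h1 := hf c (iter k T x'); have h2 := hf c (iter k T y').
  rewrite hxy in h1.
  have : `|f c (iter k T x) - f c (iter k T y)| < q * 4.
    move: xx' yy' h1 h2; rewrite !ltr_norml !ler_norml.
    move=> /andP[? ?] /andP[? ?] /andP[? ?] /andP[? ?].
    by apply/andP; split; lra.
  by rewrite qE ltxx.
by exists e => // h hf x y /He; exact.
Qed.

Lemma uniform_limit_family (F : nat -> D -> Y -> R) (de : nat -> R) :
  (forall n, continuous_family (F n)) -> (forall n, 0 < de n) ->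
  (forall m n, (n <= m)%N -> uniformly_close (de n) (F n) (F m)) ->
  (forall e, 0 < e -> exists n, de n < e) ->
  exists2 h, continuous_family h & forall n, uniformly_close (de n) (F n) h.
Proof.
move=> cF de_gt0 Fde de0.
(* The intervals of radius [de n] around [F n c y] meet pairwise, so the supremum of their left ends
   lies in all of them. *)
pose low c y := [set F n c y - de n | n in [set: nat]].
pose h c y : R := sup (low c y).
have ub c y n : ubound (low c y) (F n c y + de n).
  move=> _ [m _ <-]; have := de_gt0 n; have := de_gt0 m.
  have [nm|/ltnW mn] := leqP n m.
    by have := Fde _ _ nm c y; rewrite ler_norml => /andP[? ?]; lra.
  by have := Fde _ _ mn c y; rewrite ler_norml => /andP[? ?]; lra.
have Fh n : uniformly_close (de n) (F n) h.
  move=> c y; rewrite ler_norml; apply/andP; split.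
    rewrite lerBrDl; apply: ub_le_sup; last by exists n.
    by exists (F n c y + de n); exact: ub.
  rewrite lerBlDl; apply: ge_sup; last exact: ub.
  by exists (F n c y - de n), n.
exists h => // c x; apply/cvgrPdist_lt => /= e e0.
have e30 : 0 < e / 3 by rewrite divr_gt0.
have [n ne] := de0 _ e30.
have := near_close x (cF n c) e30; apply: filterS => y.
have := Fh n c x; have := Fh n c y; rewrite !ler_norml !ltr_norml.
by move=> /andP[? ?] /andP[? ?] /andP[? ?]; apply/andP; split; lra.
Qed.

(* Baire's argument for the open dense sets of families separating [K i]. *)
Lemma separate_countable_union (T : Y -> Y) (I : countType)
    (K : I -> set (Y * Y)) :
  continuous T -> (forall i, compact (K i)) ->
  (forall i f (eps : R), continuous_family f -> 0 < eps ->
    exists f', [/\ continuous_family f', uniformly_close eps f f' &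
      forall x y, K i (x, y) -> orbit_separated T f' x y]) ->
  forall f (eps : R), continuous_family f -> 0 < eps ->
    exists h, [/\ continuous_family h, uniformly_close eps f h &
      forall i x y, K i (x, y) -> orbit_separated T h x y].
Proof.
move=> cT cK dK f eps cf eps0.
(* A state is a closed ball in the uniform distance. [good n] places the next ball inside the
   current one, bounds its radius by [n.+1%:R^-1], and makes each family in it separate the set with
   code [n], if there is one. *)
pose state := {p : (D -> Y -> R) * R | continuous_family p.1 /\ 0 < p.2}.
pose good n (p q : state) := [/\
  uniformly_close ((sval p).2 / 2) (sval p).1 (sval q).1,
  (sval q).2 <= (sval p).2 / 2, (sval q).2 <= n.+1%:R^-1 &
  forall h i, uniformly_close (sval q).2 (sval q).1 h -> unpickle n = Some i ->
    forall x y, K i (x, y) -> orbit_separated T h x y].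
have step n (p : state) : {q | good n p q}.
  apply: cid; case: p => -[f0 d0] /= [cf0 d00].
  have d020 : 0 < d0 / 2 by rewrite divr_gt0.
  have m0 : 0 < Num.min (d0 / 2) n.+1%:R^-1 by rewrite lt_min d020/= invr_gt0.
  case ni : (unpickle n : option I) => [i|]; last first.
    exists (exist (fun p => continuous_family p.1 /\ 0 < p.2)
      (f0, Num.min (d0 / 2) n.+1%:R^-1) (conj cf0 m0)).
    split=> /=; [|by rewrite ge_min lexx|by rewrite ge_min lexx orbT|].
      by move=> c y; rewrite subrr normr0 ltW.
    by move=> h i _; rewrite ni.
  have [f1 [cf1 f10 sf1]] := dK i f0 _ cf0 d020.
  have [e e0 He] := orbit_separated_stable cT (cK i) cf1 sf1.
  have m1 : 0 < Num.min e (Num.min (d0 / 2) n.+1%:R^-1) by rewrite lt_min e0.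
  exists (exist (fun p => continuous_family p.1 /\ 0 < p.2)
    (f1, Num.min e (Num.min (d0 / 2) n.+1%:R^-1)) (conj cf1 m1)).
  split=> //=; [by rewrite !ge_min lexx orbT|by rewrite !ge_min lexx !orbT|].
  move=> h j hf1; rewrite ni => -[<-]; apply: He => c y.
  apply: le_trans (hf1 c y) _.
  by rewrite ge_min lexx.
pose s0 : state := exist (fun p => continuous_family p.1 /\ 0 < p.2)
  (f, eps) (conj cf eps0).
pose s := fix s n : state := if n is m.+1 then sval (step m (s m)) else s0.
pose F n := (sval (s n)).1; pose de n := (sval (s n)).2.
have sG n : good n (s n) (s n.+1) by exact: svalP (step n (s n)).
have cF n : continuous_family (F n) by case: (svalP (s n)).
have de0 n : 0 < de n by case: (svalP (s n)).
have FS n : uniformly_close (de n / 2) (F n) (F n.+1) by case: (sG n).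
have deS n : de n.+1 <= de n / 2 by case: (sG n).
have FD k n : uniformly_close (de n) (F n) (F (k + n)%N).
  elim: k n => [|k IH] n c y; first by rewrite subrr normr0 ltW.
  have := FS n c y; have := IH n.+1 c y; have := deS n; rewrite addnS -addSn.
  by rewrite !ler_norml => ? /andP[? ?] /andP[? ?]; apply/andP; split; lra.
have [|e e0|h ch Fh] := uniform_limit_family cF de0.
- by move=> m n nm; rewrite -(subnK nm); exact: FD.
- have [n _ /(_ n (leqnn n)) ne] := near_infty_natSinv_lt (PosNum e0).
  by exists n.+1; apply: le_lt_trans ne; case: (sG n).
exists h; split=> //; first exact: Fh 0%N.
move=> i; have [_ _ _ /(_ h i)] := sG (pickle i); apply; last exact: pickleK.
exact: Fh.
Qed.
End Baire.

(** * Periods and distinct iterates *)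

Section PeriodicPoints.
Variables (Y : Type) (T g : Y -> Y).
Hypotheses (Tg : cancel T g).

Lemma iter_modn s k y : iter s T y = y -> iter (k %% s)%N T y = iter k T y.
Proof.
move=> sy; rewrite [in RHS](divn_eq k s) addnC iterD; congr (iter _ _ _).
elim: (k %/ s)%N => [//|m IH]; by rewrite mulSn iterD -IH sy.
Qed.

Lemma periodic_pointsP k y : periodic_points T k y <->
  exists2 m, (0 < m <= k)%N & iter m T y = y.
Proof.
split=> [[m mk [m0 my _]]|[m mk my]]; first by exists m; rewrite ?m0.
pose Q m := (0 < m <= k)%N && `[< iter m T y = y >].
have Qm : Q m by rewrite /Q mk; apply/asboolP.
have exQ : exists m, Q m by exists m.
case: (ex_minnP exQ) => p /andP[/andP[p0 pk] /asboolP py] minp.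
exists p => //; split=> // j /andP[j0 jp] jy.
have : Q j by rewrite /Q j0 (leq_trans (ltnW jp) pk); apply/asboolP.
by move/minp; rewrite leqNgt jp.
Qed.

Definition distinct_iterates t y :=
  forall i j, (i < t)%N -> (j < t)%N -> iter i T y = iter j T y -> i = j.

Lemma distinct_iteratesP t y :
  (forall m, (0 < m < t)%N -> iter m T y <> y) -> distinct_iterates t y.
Proof.
move=> ht; suff lt_neq i j : (i < j < t)%N -> iter i T y <> iter j T y.
  move=> i j it jt ij; have [lij|lji|//] := ltngtP i j.
    by case: (lt_neq i j); rewrite ?lij ?jt.
  by case: (lt_neq j i); rewrite ?lji ?it.
move=> /andP[ij jt]; rewrite -(subnKC (ltnW ij)) iterD => /(iter_inj Tg) /esym.
by apply: ht; rewrite subn_gt0 ij (leq_ltn_trans (leq_subr _ _) jt).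
Qed.

Lemma exact_period s y :
  periodic_points T s y -> distinct_iterates s y -> iter s T y = y.
Proof.
move=> /periodic_pointsP[m /andP[m0 ms] my] ds.
move: ms; rewrite leq_eqVlt => /orP[/eqP<-//|ms].
have := ds m 0%N ms (leq_trans m0 (ltnW ms)) my.
by move=> m_eq0; rewrite m_eq0 in m0.
Qed.

(** [p] is the period truncated at [K]: the value [K] stands for all points without a smaller
    period, periodic or not. *)
Lemma bounded_period (K : nat) y : (0 < K)%N -> exists p,
  [/\ (0 < p <= K)%N, (p < K)%N -> periodic_points T p y &
      distinct_iterates p y].
Proof.
move=> K0.
have [[m0 mK m0y]|np] :=
  pselect (exists2 m, (0 < m < K)%N & iter m T y = y).
  pose Q m := (0 < m < K)%N && `[< iter m T y = y >].
  have exQ : exists m, Q m by exists m0; rewrite /Q mK; apply/asboolP.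
  case: (ex_minnP exQ) => p /andP[/andP[p0 pK] /asboolP py] minp.
  exists p; split; first by rewrite p0 ltnW.
    by move=> _; apply/periodic_pointsP; exists p; rewrite ?p0 ?leqnn.
  apply: distinct_iteratesP => m /andP[m1 mp] my.
  have : Q m by rewrite /Q m1 (ltn_trans mp pK); apply/asboolP.
  by move/minp; rewrite leqNgt mp.
exists K; split; rewrite ?K0 ?leqnn ?ltnn//.
by apply: distinct_iteratesP => m mK my; apply: np; exists m.
Qed.
End PeriodicPoints.

(** * Small pieces with disjoint iterates *)

Section OrbitTopology.
Variables (R : realType) (Y : topologicalType) (rho : Y -> Y -> R).
Hypothesis cm : compatible_metric rho.
Hypothesis cY : compact [set: Y].

(** Closed balls around the points of finite nets of mesh [n.+1%:R^-1]; an index past the end of a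
    net gives the empty set. Countability is what the Baire argument requires. *)
Lemma countable_closed_base : exists C : nat * nat -> set Y,
  (forall i, closed (C i)) /\
  forall x (r : R), 0 < r -> exists2 i, C i x & forall y, C i y -> rho x y < r.
Proof.
have inv_gt0 n : 0 < n.+1%:R^-1 :> R by rewrite invr_gt0.
have [s Hs] := choice (fun n => finite_net cm cY (inv_gt0 n)).
pose C (i : nat * nat) : set Y :=
  [set y | exists2 z, onth (s i.1) i.2 = Some z & rho z y <= i.1.+1%:R^-1].
exists C; split.
  move=> [n k]; rewrite /C/=; case: (onth _ k) => [z|].
    rewrite (_ : [set _ | _] = rho z @^-1` [set t | t <= n.+1%:R^-1]).
      apply: closed_comp; last exact: closed_le.
      by move=> x _; exact: cm_continuous.
    by apply/seteqP; split=> y /=; [case=> _ [<-]|exists z].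
  rewrite (_ : [set _ | _] = set0); first exact: closed0.
  by apply/seteqP; split=> y //= [].
move=> x r r0; have r20 : 0 < r / 2 by rewrite divr_gt0.
have [n _ /(_ n (leqnn n))/= nr] := near_infty_natSinv_lt (PosNum r20).
have [z zs zx] := Hs n x; exists (n, index z (s n)).
  exists z; last exact: ltW.
  by rewrite /= onthE (nth_map z) ?index_mem// nth_index.
move=> y [w /= + wy].
rewrite onthE (nth_map z) ?index_mem// nth_index// => -[zw].
rewrite -{w}zw /= in wy; have nr' : n.+1%:R^-1 < r / 2 by exact: nr.
have := cm_triangle cm x z y; rewrite (cm_sym cm x z) => xy.
by move: nr' zx wy xy; move: n.+1%:R^-1 => e ? ? ? ?; lra.
Qed.

Lemma apart_near (h k : Y -> Y) x y : continuous h -> continuous k ->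
  h x <> k y -> \forall r \near 0^'+, forall a b,
    rho x a < r -> rho y b < r -> h a <> k b.
Proof.
move=> ch ck hxky; pose q := rho (h x) (k y) / 2.
have q0 : 0 < q by rewrite divr_gt0//; apply: (cm_gt0 cm); apply/eqP.
have qE : rho (h x) (k y) = q * 2 by rewrite divfK.
have /(ball_in_nbhs cm cY)[r1 r10 Hr1] : \forall a \near x, rho (h x) (h a) < q.
  exact: ch (cm_near cm (h x) q0).
have /(ball_in_nbhs cm cY)[r2 r20 Hr2] : \forall b \near y, rho (k y) (k b) < q.
  exact: ck (cm_near cm (k y) q0).
near=> r => a b xa yb hk.
have : rho (h x) (h a) < q.
  by apply: Hr1; apply: lt_trans xa _; near: r; exact: nbhs_right_lt.
have : rho (k y) (k b) < q.
  by apply: Hr2; apply: lt_trans yb _; near: r; exact: nbhs_right_lt.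
have := cm_triangle cm (h x) (h a) (k y).
by rewrite hk (cm_sym cm (k b)) qE; lra.
Unshelve. all: by end_near. Qed.

Variables (T g : Y -> Y).
Hypotheses (cT : continuous T) (cg : continuous g).
Hypotheses (gK : cancel g T) (Tg : cancel T g).

Lemma closed_periodic_points k : closed (periodic_points T k).
Proof.
rewrite (_ : periodic_points T k =
    \bigcup_(m in [set m : 'I_k.+1 | (0 < m)%N]) [set y | iter m T y = y]).
  apply: closed_bigcup => [|m _]; first exact: finite_finset.
  rewrite -openC openE => x nx; rewrite /interior.
  have cid : continuous (@id Y) by move=> ?; exact: cvg_id.
  have /near_right0_ex[r r0 Hr] := @apart_near (iter m T) id x x
    (continuous_iter cT) cid nx.
  by have := cm_near cm x r0; apply: filterS => a xa; exact: Hr.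
apply/seteqP; split=> y.
  move=> /periodic_pointsP[m /andP[m0 mk] my].
  by exists (Ordinal (mk : (m < k.+1)%N)).
move=> [m m0 my]; apply/periodic_pointsP; exists m => //.
by rewrite m0 -ltnS ltn_ord.
Qed.

(** Distinct iterates of [x] have disjoint neighbourhoods, so whole iterates of a small ball are
    disjoint: hence two independent points [a] and [a']. *)
Lemma near_distinct_iterates t x : distinct_iterates T t x ->
  \forall r \near 0^'+, forall i j a a', (i < t)%N -> (j < t)%N ->
    rho x a < r -> rho x a' < r -> iter i T a = iter j T a' -> i = j.
Proof.
move=> dx.
have : \forall r \near 0^'+, forall e : 'I_t * 'I_t, e.1 != e.2 -> forall a a',
    rho x a < r -> rho x a' < r -> iter e.1 T a <> iter e.2 T a'.
  apply: filter_forall => -[i j]/=.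
  have [_|ij] := eqVneq i j; first exact: nearW.
  have xij : iter i T x <> iter j T x.
    move=> /(dx _ _ (ltn_ord i) (ltn_ord j))/val_inj eij.
    by rewrite eij eqxx in ij.
  apply: filterS (apart_near (continuous_iter (k := i) cT)
    (continuous_iter (k := j) cT) xij).
  by move=> r Hr _; exact: Hr.
apply: filterS => r Hr i j a a' it jt xa xa' ij.
apply: contrapT => /eqP nij.
exact: (Hr (Ordinal it, Ordinal jt) nij a a').
Qed.

Lemma near_disjoint_iterates s t x y :
  (forall i j, (i < s)%N -> (j < t)%N -> iter i T x <> iter j T y) ->
  \forall r \near 0^'+, forall i j a b, (i < s)%N -> (j < t)%N ->
    rho x a < r -> rho y b < r -> iter i T a <> iter j T b.
Proof.
move=> dxy.
have : \forall r \near 0^'+, forall e : 'I_s * 'I_t, forall a b,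
    rho x a < r -> rho y b < r -> iter e.1 T a <> iter e.2 T b.
  apply: filter_forall => -[i j]/=.
  by apply: apart_near;
    [exact: continuous_iter|exact: continuous_iter|exact: dxy].
apply: filterS => r Hr i j a b it jt.
exact: (Hr (Ordinal it, Ordinal jt)).
Qed.

End OrbitTopology.

Lemma orbit_separated_sym (R : realType) (D Y : Type) (T : Y -> Y)
    (f : D -> Y -> R) x y :
  orbit_separated T f x y -> orbit_separated T f y x.
Proof. by move=> [k [c h]]; exists k, c => /esym. Qed.

Section DenselySeparated.
Variables (R : realType) (Y : topologicalType) (rho : Y -> Y -> R).
Hypothesis cm : compatible_metric rho.
Hypothesis cY : compact [set: Y].
Variables (T g : Y -> Y).
Hypotheses (cT : continuous T) (cg : continuous g).
Hypotheses (gK : cancel g T) (Tg : cancel T g).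
Variable d : nat.

(** Compactness makes the set of families separating [K] open, the second clause makes it dense. *)
Definition densely_separated (K : set (Y * Y)) := compact K /\
  forall (f : 'I_d -> Y -> R) (eps : R), continuous_family f -> 0 < eps ->
    exists f', [/\ continuous_family f', uniformly_close eps f f' &
      forall x y, K (x, y) -> orbit_separated T f' x y].

Variable C : nat * nat -> set Y.
Hypothesis clC : forall i, closed (C i).
Hypothesis baseC : forall x (r : R), 0 < r ->
  exists2 i, C i x & forall y, C i y -> rho x y < r.

Let compact_closed_set (A : set Y) : closed A -> compact A.
Proof. by move=> clA; exact: (@subclosed_compact _ _ setT). Qed.

(** Sets of the base, small enough to have disjoint iterates, cut pieces out of [ZA] and [ZB]. By
    the last hypothesis [s] terms determine an itinerary of length [t]: either [s = t], or points of
    [ZA] near [x] have period exactly [s]. *)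
Lemma densely_separated_disjoint (s t nA nB : nat) (ZA ZB : set Y) x y :
  closed ZA -> closed ZB -> dim_le ZA nA -> dim_le ZB nB ->
  (0 < s <= t)%N -> (nA <= s * d)%N -> (nA + nB < t * d)%N ->
  ZA x -> ZB y -> distinct_iterates T s x -> distinct_iterates T t y ->
  (forall i j, (i < s)%N -> (j < t)%N -> iter i T x <> iter j T y) ->
  s = t \/ ZA `<=` periodic_points T s ->
  exists ia ib, [/\ C ia x, C ib y &
    densely_separated ((C ia `&` ZA) `*` (C ib `&` ZB))].
Proof.
move=> clZA clZB dA dB st nAs nABt Zx Zy dx dy dxy per.
have hx := near_distinct_iterates cm cY cT dx.
have hy := near_distinct_iterates cm cY cT dy.
have hxy := near_disjoint_iterates cm cY cT dxy.
have [r r0 [[Hx Hy] Hxy]] := near_right0_ex (filterI (filterI hx hy) hxy).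
have [ia Cx Hia] := baseC x r0; have [ib Cy Hib] := baseC y r0.
have clA : closed (C ia `&` ZA) by exact: closedI.
have clB : closed (C ib `&` ZB) by exact: closedI.
exists ia, ib; split=> //; split.
  by apply: compact_setX; exact: compact_closed_set.
move=> f eps cf eps0.
have [||||||f' [cf' f'f sf']] := @separate_disjoint R Y rho cm cY T g cT cg
  gK Tg d s t nA nB (C ia `&` ZA) (C ib `&` ZB) ZA ZB f eps clA clB clZA clZB _ _
  dA dB st nAs nABt _ _ _ _ cf eps0.
- by move=> ? [].
- by move=> ? [].
- by move=> i j a a' is_ js [/Hia ? _] [/Hia ? _]; exact: Hx.
- by move=> i j a a' is_ js [/Hib ? _] [/Hib ? _]; exact: Hy.
- by move=> i j a b is_ js [/Hia ? _] [/Hib ? _]; exact: Hxy.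
- move=> i a it [/Hia xa Za].
  case: per => [->|Zper]; first by rewrite modn_small.
  rewrite iter_modn//; apply: exact_period (Zper _ Za) _ => j k js ks.
  exact: (Hx j k a a).
exists f'; split=> // a b [/= [Ca Za] [Cb Zb]]; exact: sf'.
Qed.

Lemma densely_separated_shifted (t l n : nat) (Z : set Y) x :
  closed Z -> dim_le Z n -> (0 < l < t)%N -> (n + l * d < t * d)%N ->
  Z x -> distinct_iterates T t x ->
  exists ia, C ia x /\
    densely_separated [set (a, iter l T a) | a in C ia `&` Z].
Proof.
move=> clZ dZ lt nlt Zx dx.
have [r r0 Hx] := near_right0_ex (near_distinct_iterates cm cY cT dx).
have [ia Cx Hia] := baseC x r0.
have clA : closed (C ia `&` Z) by exact: closedI.
exists ia; split=> //; split.
  apply: continuous_compact; last exact: compact_closed_set.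
  apply: continuous_subspaceT => a.
  by apply: cvg_pair; [exact: cvg_id|exact: continuous_iter].
move=> f eps cf eps0.
have [||f' [cf' f'f sf']] := @separate_shifted R Y rho cm cY T g cT cg gK Tg
  d t l n (C ia `&` Z) Z f eps clA clZ _ dZ lt nlt _ cf eps0.
- by move=> ? [].
- by move=> i j a a' is_ js [/Hia ? _] [/Hia ? _]; exact: Hx.
by exists f'; split=> // a b [a' Aa [<- <-]]; exact: sf'.
Qed.

Lemma densely_separated0 : densely_separated set0.
Proof.
split=> [|f eps cf eps0]; first exact: compact0.
by exists f; split=> // c y; rewrite subrr normr0 ltW.
Qed.
End DenselySeparated.

(** * Injective orbit maps in finite dimension *)

Section FiniteDimensionalSeparation.
Variables (R : realType) (Y : topologicalType) (rho : Y -> Y -> R).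
Hypothesis cm : compatible_metric rho.
Hypothesis cY : compact [set: Y].
Variables (T g : Y -> Y).
Hypotheses (cT : continuous T) (cg : continuous g).
Hypotheses (gK : cancel g T) (Tg : cancel T g).
Variables (d N : nat) (n : nat -> nat).
Hypothesis d_gt0 : (0 < d)%N.
Hypothesis dimY : dim_le [set: Y] N.
Hypothesis dimP : forall k, (0 < k)%N -> dim_le (periodic_points T k) (n k).
Hypothesis n_lt : forall k, (0 < k)%N -> ((n k).*2 < k * d)%N.

Lemma finite_dim_separation (f : 'I_d -> Y -> R) (eps : R) :
  continuous_family f -> 0 < eps ->
  exists h, [/\ continuous_family h, uniformly_close eps f h &
    forall x y, x <> y -> orbit_separated T h x y].
Proof.
move=> cf eps0; have [C [clC baseC]] := countable_closed_base cm cY.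
(* Points without a period < K = 2M form one class. Two such points are
   separated at times < M, unless one is T^l of the other with l < M; then all
   K times are used, and l <= K/2. *)
pose M := N.*2.+1; pose K := M.*2.
have NM : (N.*2 < M * d)%N by rewrite leq_pmulr.
have M_gt0 : (0 < M)%N by [].
have MK : (M < K)%N by rewrite /K -addnn; lia.
(* A closed set containing the points of truncated period [p]. Smaller periods also occur in it, but
   not near a point with [p] distinct iterates. *)
pose Z p := if (p < K)%N then periodic_points T p else [set: Y].
pose nn p := if (p < K)%N then n p else N.
have clZ p : closed (Z p).
  rewrite /Z; case: ifP => _; last exact: closedT.
  exact: (closed_periodic_points cm cY).
have dZ p : (0 < p)%N -> dim_le (Z p) (nn p).
  by move=> p0; rewrite /Z /nn; case: ifP => _ //; exact: dimP.
have nnlt p : (0 < p <= K)%N -> ((nn p).*2 < p * d)%N.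
  move=> /andP[p0 pK]; rewrite /nn; case: ifP => pK'; first exact: n_lt.
  have -> : p = K by lia.
  by apply: leq_trans NM _; rewrite leq_mul2r (ltnW MK) orbT.
pose dsep := @densely_separated R Y T d.
pose L0 (i : (nat * nat) * (nat * nat) * (nat * nat)
             + (nat * nat) * (nat * nat)) : set (Y * Y) := match i with
  | inl (ia, ib, (p, q)) => (C ia `&` Z p) `*` (C ib `&` Z q)
  | inr (ia, (p, l)) => [set (a, iter l T a) | a in C ia `&` Z p] end.
(* Pieces that are not densely separated are replaced by the empty set, so that Baire applies to all
   indices; each pair then only needs one good piece. *)
pose L i := if `[< dsep (L0 i) >] then L0 i else set0.
have dL i : dsep (L i).
  by rewrite /L; case: asboolP => // _; exact: densely_separated0.
have [h [ch hf sh]] := separate_countable_union cT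
  (fun i => (dL i).1) (fun i => (dL i).2) cf eps0.
exists h; split=> // x y xy.
have sepL i u v : dsep (L0 i) -> L0 i (u, v) -> orbit_separated T h u v.
  by move=> di Li; apply: (sh i); rewrite /L asboolT.
have ok1 s t p q u v : (0 < s <= t)%N -> (0 < p)%N -> (0 < q)%N ->
    (nn p <= s * d)%N -> (nn p + nn q < t * d)%N ->
    Z p u -> Z q v -> distinct_iterates T s u -> distinct_iterates T t v ->
    (forall i j, (i < s)%N -> (j < t)%N -> iter i T u <> iter j T v) ->
    s = t \/ Z p `<=` periodic_points T s -> orbit_separated T h u v.
  move=> st p0 q0 nps npq Zu Zv du dv duv per.
  have [ia [ib [Cu Cv dI]]] := densely_separated_disjoint cm cY cT cg gK Tg
    clC baseC (clZ p) (clZ q) (dZ _ p0) (dZ _ q0) st nps npq Zu Zv du dv duv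
    per.
  exact: (sepL (inl (ia, ib, (p, q)))).
have ok2 t l p u : (0 < p)%N -> (0 < l < t)%N -> (nn p + l * d < t * d)%N ->
    Z p u -> distinct_iterates T t u -> orbit_separated T h u (iter l T u).
  move=> p0 lt nlt Zu du.
  have [ia [Cu dI]] := densely_separated_shifted cm cY cT cg gK Tg clC baseC
    (clZ p) (dZ _ p0) lt nlt Zu du.
  by apply: (sepL (inr (ia, (p, l)))) => //; exists u.
have K0 : (0 < K)%N by lia.
have [p [/andP[p0 pK] Pp dx]] := bounded_period Tg x K0.
have [q [/andP[q0 qK] Pq dy]] := bounded_period Tg y K0.
have Zp : Z p x by rewrite /Z; case: ifP.
have Zq : Z q y by rewrite /Z; case: ifP.
wlog pq : x y p q p0 pK Pp dx q0 qK Pq dy Zp Zq xy / (p <= q)%N.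
  move=> H; have [pq|/ltnW qp] := leqP p q; first exact: (H x y p q).
  by apply/orbit_separated_sym/(H y x q p) => // /esym.
have np := nnlt p; have nq := nnlt q.
have npd : ((nn p).*2 < p * d)%N by apply: np; rewrite p0.
have nqd : ((nn q).*2 < q * d)%N by apply: nq; rewrite q0.
have pqd : (p * d <= q * d)%N by rewrite leq_mul2r pq orbT.
(* If [p = K] then [q = K] too, and the dimension bound [N] of the whole space is used. *)
have [pltK|Kp] := ltnP p K; last first.
  have pE : p = K by lia.
  have qE : q = K by lia.
  have nnK : nn K = N by rewrite /nn ltnn.
  have KdE : (K * d = M * d + M * d)%N by rewrite /K -addnn mulnDl.
  have shift_case u v l : (0 < l < M)%N -> v = iter l T u -> Z K u ->
      distinct_iterates T K u -> orbit_separated T h u v.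
    move=> /andP[l0 lM] -> Zu du; apply: (ok2 K l K) => //.
      by rewrite l0 (ltn_trans lM MK).
    have : (l * d <= M * d)%N by rewrite leq_mul2r (ltnW lM) orbT.
    by rewrite nnK KdE; lia.
  have [[l lM yx]|nyx] := pselect (exists2 l, (0 < l < M)%N & y = iter l T x).
    by apply: (shift_case _ _ l) => //; rewrite -pE.
  have [[l lM yx']|nxy] := pselect (exists2 l, (0 < l < M)%N & x = iter l T y).
    by apply/orbit_separated_sym/(shift_case _ _ l) => //; rewrite -qE.
  (* The first [M] iterates of [x] and [y] do not meet, and [M] terms suffice because
     [N + N < M * d]. *)
  apply: (ok1 M M p q) => //.
  - by rewrite leqnn.
  - by rewrite pE nnK; lia.
  - by rewrite pE qE nnK; lia.
  - by move=> i j iM jM; apply: dx; lia.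
  - by move=> i j iM jM; apply: dy; lia.
  - move=> i j iM jM ij; have [lij|lji|eij] := ltngtP i j.
    + apply: nxy; exists (j - i)%N; first by lia.
      by apply: (iter_inj (k := i) Tg); rewrite -iterD subnKC// ltnW.
    + apply: nyx; exists (i - j)%N; first by lia.
      by apply: (iter_inj (k := j) Tg); rewrite -iterD subnKC// ltnW.
    + by apply: xy; apply: (iter_inj (k := i) Tg); rewrite ij eij.
  - by left.
have ZpE : Z p = periodic_points T p by rewrite /Z pltK.
have px : iter p T x = x by apply: exact_period dx; rewrite -ZpE.
have [[l lp yx]|nyx] := pselect (exists2 l, (l < p)%N & y = iter l T x).
  have l0 : (0 < l)%N by case: l yx {lp} => // yx; case: xy.
  have py : iter p T y = y by rewrite yx -iterD addnC iterD px.
  (* One of the shifts [l] from [x] to [y] and [p - l] from [y] to [x] is at most half of [p], while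
     [nn p] is less than half of [p * d]. *)
  have [l2|l2] := leqP l.*2 p.
    rewrite yx; apply: (ok2 p l p) => //; first by rewrite l0.
    have : (l.*2 * d <= p * d)%N by rewrite leq_mul2r l2 orbT.
    by rewrite -addnn mulnDl; lia.
  have xE : x = iter (p - l) T y by rewrite yx -iterD subnK ?px// ltnW.
  apply: orbit_separated_sym; rewrite [X in orbit_separated _ _ _ X]xE.
  apply: (ok2 p (p - l)%N p) => //; first by lia.
  - have : ((p - l).*2 * d <= p * d)%N by rewrite leq_mul2r; lia.
    by rewrite -addnn mulnDl; lia.
  - by rewrite ZpE; apply/periodic_pointsP; exists p; rewrite ?p0 ?leqnn.
  - move=> i j ip jp; rewrite yx -!iterD ![(_ + l)%N]addnC !iterD.
    by move/(iter_inj Tg); exact: dx.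
(* The orbits are distinct: the [p]-periodic itinerary of [x], repeated up to length [q], is
   compared with [q] terms of that of [y]. *)
apply: (ok1 p q p q) => //.
- by rewrite p0.
- by lia.
- by lia.
- move=> i j ip jq ij; apply: nyx.
  (* This is [i - j] modulo [p], with [- j] replaced by [j * p.-1] to stay in the natural
     numbers. *)
  exists ((i + j * p.-1) %% p)%N; first by rewrite ltn_mod.
  rewrite iter_modn//; apply: (iter_inj (k := j) Tg).
  rewrite -ij -iterD (_ : (_ + _ = i + j * p)%N); last by nia.
  by rewrite -(iter_modn (i + j * p) px) addnC modnMDl iter_modn.
- by right; rewrite ZpE.
Qed.
End FiniteDimensionalSeparation.

(** * Topological dimension *)

(** Since [s] has no repetitions, counting indices of sets containing [y] is the same as summing
    indicators over the members. *)
Lemma cover_ord_multiplicity (R : realType) (Y : topologicalType)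
    (s : seq (set Y)) (n : nat) : uniq s ->
  (@cover_ord R Y [set` s] < n.+1%:R%:E)%E ->
  forall y,
    (#|[pred j : 'I_(size s) | `[< tnth (in_tuple s) j y >]]| <= n.+1)%N.
Proof.
move=> us ltn y; rewrite -ltnS -(ltr_nat R).
have : \sum_(U \in [set` s]) (\1_U y : R) - 1 < n.+1%:R.
  rewrite -lte_fin EFinB; apply: le_lt_trans ltn; rewrite /cover_ord leeB//.
  by apply: ereal_sup_ubound; exists y.
rewrite ltrBlDr -fsbig_seq// big_tnth natr1.
congr (_ < _); rewrite -sum1_card natr_sum [RHS]big_mkcond/=.
apply: eq_bigr => j _; rewrite indicE inE.
by rewrite (_ : (y \in _) = `[< tnth (in_tuple s) j y >])//; case: asboolP.
Qed.

(** A strict bound passes from the infimum to some refinement, whose multiplicities are integers. In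
    the empty space each cover serves as its own refinement. *)
Lemma topdim_dim_le (R : realType) (Y : topologicalType) (n : nat) :
  (topdim R Y < n.+1%:R%:E)%E -> dim_le [set: Y] n.
Proof.
rewrite /topdim; case: asboolP => [Y0 _|_ dimY]; move=> I U oU YU.
  exists I, U, id; split=> [//|//|j y //|z _].
  by have : [set: Y] z by []; rewrite Y0.
have : finite_open_cover (range U).
  split; [exact: finite_image finite_finset|by move=> _ [i _ <-]; exact: oU|].
  by rewrite eqEsubset; split=> // y /YU[i _ Uy]; exists (U i) => //; exists i.
move=> fU; have : (@cover_dim R Y (range U) < n.+1%:R%:E)%E.
  by apply: le_lt_trans dimY; apply: ereal_sup_ubound; exists (range U).
move=> /ereal_inf_lt[_ [beta [[fb ob Yb] refb] <-]].
have /finite_seqP[s0 bE] := fb; pose s := undup s0.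
have {}bE : beta = [set` s].
  by rewrite bE; apply/seteqP; split=> V /=; rewrite mem_undup.
rewrite {}bE in ob Yb refb *.
move=> /cover_ord_multiplicity mult.
have ms (j : 'I_(size s)) : tnth (in_tuple s) j \in s by exact: mem_tnth.
have ref j : exists i, tnth (in_tuple s) j `<=` U i.
  by have [_ [i _ <-] ?] := refb _ (ms j); exists i.
have [phi Hphi] := choice ref.
exists 'I_(size s), (tnth (in_tuple s)), phi; split=> //.
- by move=> j; apply: ob; exact: ms.
- move=> y _; have : (\bigcup_(V in [set` s]) V) y by rewrite Yb.
  move=> [V /= Vs Vy]; have Vi : (index V s < size s)%N by rewrite index_mem.
  by exists (Ordinal Vi) => //=; rewrite (tnth_nth V)/= nth_index.
- by move=> z _; apply: mult; exact: undup_uniq.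
Qed.

(** Relatively open sets extend to open sets of [Y]; intersecting with [U (phi j)] restores the
    inclusion outside [Z]. *)
Lemma dim_le_subspace (Y : topologicalType) (Z : set Y) n :
  dim_le [set: set_type Z] n -> dim_le Z n.
Proof.
move=> dZ I U oU ZU.
have oU' i : open ((@set_val _ Z) @^-1` U i) by exists (U i).
have ZU' : [set: set_type Z] `<=` \bigcup_i ((@set_val _ Z) @^-1` U i).
  by move=> z _; have [i _ Uz] := ZU _ (set_valP z); exists i.
have [J [V' [phi [oV' ZV' V'U mult]]]] := dZ I _ oU' ZU'.
have /choice[W HW] : forall j, exists W, open W /\ set_val @^-1` W = V' j.
  by move=> j; have [W oW WV] := oV' j; exists W.
exists J, (fun j => W j `&` U (phi j)), phi; split.
- by move=> j; apply: openI; [case: (HW j)|exact: oU].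
- move=> z Zz; have [j _ Vj] := ZV' (SigSub (mem_set Zz)) Logic.I.
  exists j => //; split; last exact: V'U Vj.
  by move: Vj; rewrite -(HW j).2.
- by move=> j y [].
- move=> z Zz; apply: leq_trans (mult (SigSub (mem_set Zz)) Logic.I).
  apply: subset_leq_card; apply/fintype.subsetP => j; rewrite !inE => -[Wz _].
  by rewrite -(HW j).2.
Qed.

Lemma foldr_muln_leq (T : Type) (s : seq T) (F G : T -> nat) :
  (forall x, (F x <= G x)%N) ->
  (foldr muln 1%N (map F s) <= foldr muln 1%N (map G s))%N.
Proof. by move=> FG; elim: s => //= x s IH; rewrite leq_mul. Qed.

(** * Finite products *)

Section Product.
Variables (R : realType) (n : nat) (X : 'I_n -> metricType R).

Definition prod_dist (x y : prod_space (fun i => X i)) : R :=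
  \sum_i mdist (x i) (y i).

Lemma continuous_proj (I : eqType) (Z : I -> topologicalType) i :
  continuous (fun x : prod_space Z => x i).
Proof. exact: (@proj_continuous I Z i). Qed.

Lemma mdist_continuous (M : metricType R) (x : M) : continuous (mdist x).
Proof.
move=> y; apply/cvgrPdist_lt => e e0; have := nbhsx_ballx y e e0.
apply: filterS => z; rewrite ballEmdist/= => yz.
have := metric_triangle x y z; have := metric_triangle x z y.
by rewrite (metric_sym z y) ltr_norml => ? ?; apply/andP; split; lra.
Qed.

Lemma prod_dist_compatible : compatible_metric prod_dist.
Proof.
split.
- by move=> x y; apply: sumr_ge0 => i _; exact: mdist_ge0.
- by move=> x; rewrite /prod_dist big1// => i _; exact: mdistxx.
- move=> x y xy; apply: functional_extensionality_dep => i.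
  apply: mdist_positivity; apply/eqP; move/eqP: xy.
  rewrite psumr_eq0; last by move=> j _; exact: mdist_ge0.
  by move/allP/(_ i); rewrite mem_index_enum => /(_ isT).
- by move=> x y; apply: eq_bigr => i _; exact: metric_sym.
- move=> x y z; rewrite -big_split/=; apply: ler_sum => i _.
  exact: metric_triangle.
- move=> x; apply: continuous_sums => i _ y.
  apply: continuous_comp; [exact: continuous_proj|exact: mdist_continuous].
Qed.

Lemma mdist_compatible (M : metricType R) : compatible_metric (@mdist R M).
Proof.
split; [exact: mdist_ge0|exact: mdistxx|exact: mdist_positivity|
  exact: metric_sym|exact: metric_triangle|exact: mdist_continuous].
Qed.

Hypothesis cX : forall i, compact [set: X i].

Lemma prod_space_compact (I : eqType) (Z : I -> topologicalType) :
  (forall i, compact [set: Z i]) -> compact [set: prod_space Z].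
Proof.
move=> cZ; have := tychonoff cZ; congr (compact _).
by apply/seteqP; split.
Qed.

(** Products of fine covers of the factors have multiplicity at most the product of the
    multiplicities. This crude bound is enough, as only finiteness is needed. *)
Lemma dim_le_prod (N : 'I_n -> nat) : [set: prod_space (fun i => X i)] !=set0 ->
  (forall i, dim_le [set: X i] (N i)) ->
  exists M, dim_le [set: prod_space (fun i => X i)] M.
Proof.
move=> [x0 _] dX; exists (foldr muln 1%N [seq (N k).+1 | k : 'I_n]).
move=> I U oU YU.
have cm := prod_dist_compatible.
have cY := prod_space_compact cX.
have [r r0 Hr] := lebesgue_number cm cY (@closedT _) oU YU.
(* Factor sets of diameter at most [2 * e] have products of diameter at most
   [n * (2 * e) = r - 2 * e < r], also for [n = 0]. *)
pose e := r / 2 / n.+1%:R.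
have e0 : 0 < e by rewrite !divr_gt0.
have small k : exists (J : finType) (V : J -> set (X k)),
    [/\ forall j, open (V j), [set: X k] `<=` \bigcup_j V j,
        forall j y y', V j y -> V j y' -> mdist y y' < 2 * e &
        forall y, (#|[pred j | `[< V j y >]]| <= (N k).+1)%N].
  have cmk := mdist_compatible (X k).
  have [s Hs] := finite_net cmk (@cX k) e0.
  have oB (j : 'I_(size s)) : open [set y | mdist (tnth (in_tuple s) j) y < e].
    exact: (open_cm_ball cmk).
  have YB : [set: X k] `<=` \bigcup_(j in [set: 'I_(size s)])
      [set y | mdist (tnth (in_tuple s) j) y < e].
    move=> y _; have [z zs zy] := Hs y.
    have zi : (index z s < size s)%N by rewrite index_mem.
    by exists (Ordinal zi) => //=; rewrite (tnth_nth z)/= nth_index.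
  have [J [V [phi [oV YV VB mult]]]] := dX k _ _ oB YB.
  exists J, V; split=> // [j y y' /VB/= yj /VB/= y'j|y]; last exact: mult.
  have := metric_triangle y (tnth (in_tuple s) (phi j)) y'.
  by rewrite (metric_sym y (tnth _ _)); lra.
pose J k := projT1 (cid (small k)).
pose V k : J k -> set (X k) := projT1 (cid (projT2 (cid (small k)))).
have HV k : [/\ forall j, open (@V k j), [set: X k] `<=` \bigcup_j @V k j,
        forall j y y', @V k j y -> @V k j y' -> mdist y y' < 2 * e &
        forall y, (#|[pred j | `[< @V k j y >]]| <= (N k).+1)%N] :=
  projT2 (cid (projT2 (cid (small k)))).
pose W (p : {dffun forall k, J k}) : set (prod_space (fun i => X i)) :=
  [set x | forall k, @V k (p k) (x k)].
have WU p : exists i, W p `<=` U i.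
  (* An empty product set still needs an index, which [x0] supplies. *)
  have [[x Wx]|W0] := pselect (W p !=set0); last first.
    by have [i _ _] := YU x0 Logic.I; exists i => y Wy; case: W0; exists y.
  have [i Hi] := Hr x Logic.I; exists i => y Wy; apply: Hi.
  apply: (@le_lt_trans _ _ (\sum_(k < n) 2 * e)).
    apply: ler_sum => k _; have [_ _ Vd _] := HV k.
    exact/ltW/(Vd _ _ _ (Wx k) (Wy k)).
  have eE : e * n%:R + e = r / 2.
    by rewrite -[X in _ + X]mulr1 -mulrDr natr1 divfK.
  by rewrite sumr_const card_ord -mulr_natr -mulrA; lra.
have [phi Hphi] := choice WU.
exists {dffun forall k, J k}, W, phi; split=> //.
- move=> p; rewrite openE => x Wx; rewrite /interior.
  apply: (@filter_forall _ 'I_n (fun k => [set y | @V k (p k) (y k)]) (nbhs x)).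
  move=> k; have [oV _ _ _] := HV k.
  exact: (continuous_proj (open_nbhs_nbhs (conj (oV (p k)) (Wx k)))).
- move=> x _; have cov k : exists j, @V k j (x k).
    by have [_ YV _ _] := HV k; have [j _ ?] := YV (x k) Logic.I; exists j.
  exists [ffun k => projT1 (cid (cov k))] => // k; rewrite ffunE.
  exact: projT2 (cid (cov k)).
- move=> x _; pose F k := [pred j | `[< @V k j (x k) >]].
  apply: (@leq_trans #|(family F : simpl_pred {dffun forall k, J k})|).
    apply: subset_leq_card; apply/fintype.subsetP => p; rewrite !inE => Wp.
    by apply/familyP => k; rewrite !inE; exact: Wp.
  rewrite card_family; apply: leqW; apply: foldr_muln_leq => k.
  by have [_ _ _] := HV k; apply.
Qed.
End Product.

(** * Infinite products and embeddings *)

Lemma cvg_prod_space (S I : Type) (Z : I -> topologicalType)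
    (F : set_system S) (h : S -> prod_space Z) (z : prod_space Z) :
  Filter F -> (forall i, (fun s => h s i) @ F --> z i) -> h @ F --> z.
Proof.
move=> FF hz; apply/cvg_sup => i U [V [[W oW <-] Wz WU]].
apply: (filterS WU); apply: (hz i W).
by apply: open_nbhs_nbhs; split.
Qed.

Lemma continuous_prod_space (A : topologicalType) (I : Type)
    (Z : I -> topologicalType) (h : A -> prod_space Z) :
  (forall i, continuous (fun a => h a i)) -> continuous h.
Proof. by move=> ch x; apply: cvg_prod_space => i; exact: ch. Qed.

Lemma real_separated_hausdorff (R : realType) (A : topologicalType) :
  (forall x y : A, x <> y -> exists2 f : A -> R, continuous f & f x <> f y) ->
  hausdorff_space A.
Proof.
move=> sepA x y cl; apply: contrapT => /sepA[f cf fxy].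
pose e := `|f x - f y| / 2.
have e0 : 0 < e by rewrite divr_gt0// normr_gt0 subr_eq0; apply/eqP.
have eE : `|f x - f y| = e * 2 by rewrite divfK.
have [z [/= xz yz]] := cl _ _ (near_close x cf e0) (near_close y cf e0).
have : `|f x - f y| < e * 2.
  move: xz yz; rewrite !ltr_norml => /andP[? ?] /andP[? ?].
  by apply/andP; split; lra.
by rewrite eE ltxx.
Qed.

Lemma set_val_continuous (A : topologicalType) (Z : set A) :
  continuous (@set_val A Z).
Proof. exact: initial_continuous. Qed.

Lemma continuous_set_type (A B : topologicalType) (Z : set B)
    (h : A -> set_type Z) :
  continuous (fun a => set_val (h a)) -> continuous h.
Proof. exact: (@continuous_comp_initial _ _ _ (@set_val B Z)). Qed.

(** Closed subsets of [A] are compact, so their images are closed, and these are their preimages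
    under the inverse. *)
Lemma compact_embedding (A B : topologicalType) (phi : A -> B) :
  compact [set: A] -> hausdorff_space B -> continuous phi -> injective phi ->
  homeomorphism_onto_image phi.
Proof.
move=> cA hB cphi iphi.
have rphi x : phi x \in range phi by apply/mem_set; exists x.
exists (fun x => SigSub (rphi x)) => //; split.
  exact: continuous_set_type.
have ex (z : set_type (range phi)) : exists x, phi x = set_val z.
  by have [x _ xz] := set_valP z; exists x.
have [g gE] := choice ex.
exists g; split; last first.
- by move=> z; apply/val_inj; rewrite /= gE.
- by move=> x; apply: iphi; rewrite gE.
apply/continuous_closedP => C clC.
rewrite (_ : g @^-1` C = set_val @^-1` (phi @` C)).
  apply: closed_comp => [z _|]; first exact: set_val_continuous.
  apply: compact_closed => //; apply: continuous_compact.
    exact: continuous_subspaceT.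
  exact: (@subclosed_compact _ _ setT).
apply/seteqP; split=> z /=; first by exists (g z); rewrite ?gE.
by move=> [x Cx xz]; rewrite (_ : g z = x)//; apply: iphi; rewrite gE.
Qed.

Lemma compact_family_bounded (R : realType) (A : topologicalType) (D : finType)
    (f : D -> A -> R) : compact [set: A] -> continuous_family f ->
  exists2 B : R, 0 < B & forall c x, `|f c x| <= B.
Proof.
move=> /compact_near_coveringP cA cf.
have [] : \forall B \near +oo, [set: A] `<=` (fun x => forall c, `|f c x| <= B).
  apply: (cA _ _ (fun B x => forall c, `|f c x| <= B)) => x _.
  have nx : \forall y \near x, forall c, `|f c x - f c y| < 1.
    by apply: filter_forall => c; exact: near_close.
  have nB : \forall B \near +oo, \sum_c `|f c x| + 1 <= B.
    by apply: nbhs_pinfty_ge; exact: num_real.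
  near=> y B => /= c.
  have h1 : `|f c x - f c y| < 1 by move: c; near: y.
  have h2 : \sum_c `|f c x| + 1 <= B by near: B.
  have h3 : `|f c x| <= \sum_c `|f c x| by rewrite (bigD1 c)//= lerDl sumr_ge0.
  move: h1 h3; move: (\sum_c _) h2 => s h2.
  rewrite ltr_norml !ler_norml => /andP[? ?] /andP[? ?].
  by apply/andP; split; lra.
move=> B0 [_ HB]; pose B := Num.max B0 0 + 1.
have BB0 : B0 < B by rewrite ltr_pwDr// le_max lexx.
exists B; first by rewrite ltr_wpDl// le_max lexx orbT.
by move=> c x; exact: HB.
Unshelve. all: by end_near. Qed.

(** * From separated orbits to the shift *)

Section ShiftEmbedding.
Variables (R : realType) (Y : topologicalType) (T g : Y -> Y) (d : nat).
Hypotheses (cY : compact [set: Y]) (cT : continuous T) (cg : continuous g).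
Hypotheses (Tg : cancel T g).

Definition iterz (k : int) (x : Y) : Y :=
  match k with Posz n => iter n T x | Negz n => iter n.+1 g x end.

Lemma iterzS k x : iterz k (T x) = iterz (k + 1) x.
Proof.
case: k => [n|[|n]].
- by rewrite -PoszD addn1 /= -iterSr.
- by rewrite /= Tg.
- rewrite (_ : Negz n.+1 + 1 = Negz n); last by rewrite !NegzE; lia.
  by rewrite /iterz iterSr Tg.
Qed.

Lemma continuous_iterz k : continuous (iterz k).
Proof.
case: k => n; rewrite /iterz; first exact: (continuous_iter (k := n) cT).
exact: (continuous_iter (k := n.+1) cg).
Qed.

(** Two-sided itineraries of a rescaled [h] give the embedding; injectivity is already visible at
    nonnegative times. *)
Lemma shift_embedding (h : 'I_d -> Y -> R) : continuous_family h ->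
  (forall x y, x <> y -> orbit_separated T h x y) ->
  embeds T (@shift R d).
Proof.
move=> ch sh; have [B B0 hB] := compact_family_bounded cY ch.
(* An injective affine rescaling of [[-B, B]] onto [[0, 1]], so separation is preserved. *)
pose q c x := (h c x / B + 1) / 2.
have qP c x : q c x \in (`[0, 1]%classic : set R).
  apply/mem_set; rewrite /= in_itv/=.
  have : `|h c x / B| <= 1.
    by rewrite normrM normfV (gtr0_norm B0) ler_pdivrMr// mul1r.
  by rewrite /q ler_norml => /andP[? ?]; apply/andP; split; lra.
pose phi (x : Y) : shift_space R d := fun k c => SigSub (qP c (iterz k x)).
have cphi : continuous phi.
  apply: continuous_prod_space => k; apply: continuous_prod_space => c.
  have cq : continuous (q c).
    apply: continuous_mul; last exact: continuous_cst_fun.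
    apply: continuous_add; last exact: continuous_cst_fun.
    by apply: continuous_mul; [exact: ch|exact: continuous_cst_fun].
  apply: continuous_set_type => x.
  apply: (@continuous_comp _ _ _ (iterz k) (q c)); last exact: cq.
  exact: continuous_iterz.
exists phi.
  apply: compact_embedding => //.
  - apply: (@real_separated_hausdorff R) => x y xy.
    have [k [c kc]] : exists k c, set_val (x k c) <> set_val (y k c).
      apply: contrapT => nk; apply: xy; apply/funext => k; apply/funext => c.
      by apply/val_inj; apply: contrapT => kc; apply: nk; exists k, c.
    exists (fun z : shift_space R d => set_val (z k c)) => // z.
    apply: (@continuous_comp _ _ _ (fun z : shift_space R d => z k c) set_val);
      last exact: set_val_continuous.
    apply: (@continuous_comp _ _ _ (fun z : shift_space R d => z k)
      (fun w : cube R d => w c)).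
      exact: continuous_proj.
    exact: continuous_proj.
  - move=> x y xy; apply: contrapT => /sh[k [c]]; apply.
    have := congr1 (fun z : shift_space R d => set_val (z (Posz k) c)) xy.
    have B_neq0 : B^-1 != 0 by rewrite invr_neq0// gt_eqF.
    have two_neq0 : 2^-1 != 0 :> R by rewrite invr_neq0.
    by rewrite /phi /= /q => /(mulIf two_neq0) /addIr /(mulIf B_neq0).
move=> x; apply/funext => k; apply/funext => c; apply/val_inj.
by rewrite /phi /shift /= iterzS.
Qed.
End ShiftEmbedding.

(** * Infinite products and their partial products *)

Section InfiniteProduct.
Variables (R : realType) (X : nat -> metricType R).
Hypothesis X0 : forall i, [set: X i] !=set0.
Hypothesis cX : forall i, compact [set: X i].

Local Notation XX := (prod_space (fun i => X i)).
Local Notation Xn n := (partial_prod (fun i => X i) n).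

Let cXX : compact [set: XX].
Proof. exact: prod_space_compact. Qed.

Let base : XX := fun i => projT1 (cid (X0 i)).

Definition restrict n (x : XX) : Xn n := fun i => x i.
Arguments restrict : clear implicits.

(** The test is abstracted together with its equation, so that the true branch has the proof that
    [Ordinal] requires and case analysis remains possible. Missing coordinates come from [base]. *)
Definition extend_coord n (y : Xn n) i (b : bool) : (i < n)%N = b -> X i :=
  if b as b' return (i < n)%N = b' -> X i
  then fun lt_in => y (Ordinal lt_in) else fun _ => base i.

Definition extend n (y : Xn n) : XX :=
  fun i => extend_coord y (erefl (i < n)%N).

Lemma continuous_restrict n : continuous (@restrict n).
Proof. by apply: continuous_prod_space => i; exact: continuous_proj. Qed.

Lemma continuous_extend n : continuous (@extend n).
Proof.
apply: continuous_prod_space => i.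
suff ce b (e : (i < n)%N = b) : continuous (fun y : Xn n => extend_coord y e).
  exact: ce.
case: b e => e; last first.
  exact: (@cst_continuous (Xn n) (X i) (base i)).
exact: (@continuous_proj _ (fun i : 'I_n => X i) (Ordinal e)).
Qed.

Lemma extend_restrict n x i : (i < n)%N -> extend (restrict n x) i = x i.
Proof.
move=> lt_in.
suff xE b (e : (i < n)%N = b) : b -> extend_coord (restrict n x) e = x i.
  exact: xE.
by case: b e.
Qed.

(** [extend (restrict n y)] tends to [x] as [y] tends to [x] and [n] to infinity jointly;
    compactness makes the resulting threshold for [n] uniform. *)
Lemma finite_coordinates_approx d (f : 'I_d -> XX -> R) (eps : R) :
  continuous_family f -> 0 < eps ->
  exists N, forall n, (N <= n)%N -> forall c x,
    `|f c (extend (restrict n x)) - f c x| <= eps.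
Proof.
move=> cf e0; have e20 : 0 < eps / 2 by rewrite divr_gt0.
move/compact_near_coveringP: cXX => cXX'.
pose P n x := forall c, `|f c (extend (restrict n x)) - f c x| <= eps.
have [N _ HN] : \forall n \near \oo, [set: XX] `<=` P n.
  apply: cXX' => x _.
  pose A := [set y | forall c, `|f c x - f c y| < eps / 2].
  have nA : nbhs x A.
    apply: (@filter_forall _ 'I_d
      (fun c => [set y | `|f c x - f c y| < eps / 2]) (nbhs x)) => c.
    exact: (near_close x (cf c) e20).
  have cv : (fun p : XX * nat => extend (restrict p.2 p.1)) @ (nbhs x, \oo)
      --> (x : XX).
    apply: cvg_prod_space => i V Vx.
    exists ([set y : XX | V (y i)], [set n | (i < n)%N]) => /=.
      split; last by exists i.+1.
      exact: (@continuous_proj _ (fun i => X i) i x V Vx).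
    by move=> [y n] /= [Vy lt_in]; rewrite extend_restrict.
  have near_ext : filter_prod (nbhs x) \oo
    [set p : XX * nat | A (extend (restrict p.2 p.1))] := cv A nA.
  have near_fst : filter_prod (nbhs x) \oo [set p : XX * nat | A p.1].
    by exists (A, setT) => [|[y n] []//]; split=> //; exact: filterT.
  apply: filterS (filterI near_ext near_fst) => -[y n] [/= Ay Ay'] c.
  have := Ay c; have := Ay' c; rewrite !ltr_norml ler_norml.
  by move=> /andP[? ?] /andP[? ?]; apply/andP; split; lra.
by exists N => n Nn c x; exact: (HN n Nn x).
Qed.

Variable T : forall i, X i -> X i.
Arguments T : clear implicits.
Hypothesis hT : forall i, homeomorphism (T i).

Let Tinv i : X i -> X i := projT1 (cid (hT i).2).
Arguments Tinv : clear implicits.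
Let TinvP i : [/\ continuous (Tinv i), cancel (T i) (Tinv i) &
    cancel (Tinv i) (T i)] :=
  projT2 (cid (hT i).2).

Local Notation TT := (prod_map (fun i => X i) T).
Local Notation Tn n := (partial_map (fun i => X i) T n).

Lemma continuous_prod_map (I : eqType) (Z : I -> topologicalType)
    (S : forall i, Z i -> Z i) :
  (forall i, continuous (S i)) -> continuous (prod_map Z S).
Proof.
move=> cS; apply: continuous_prod_space => i x.
apply: (@continuous_comp _ _ _ (fun x : prod_space Z => x i) (S i));
  last exact: cS.
exact: continuous_proj.
Qed.

Lemma prod_mapK (I : Type) (Z : I -> topologicalType)
    (S S' : forall i, Z i -> Z i) :
  (forall i, cancel (S i) (S' i)) -> cancel (prod_map Z S) (prod_map Z S').
Proof.
by move=> SK x; apply: functional_extensionality_dep => i; exact: SK.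
Qed.

Lemma iter_restrict n k x :
  iter k (Tn n) (restrict n x) = restrict n (iter k TT x).
Proof. by elim: k => //= k ->. Qed.

(* Every continuous function on the full product is uniformly close to one
   that factors through a partial product on which the finite-dimensional
   theorem holds. *)
Lemma product_embedding (d : nat) :
  (forall N, exists2 n, (N <= n)%N & forall (f : 'I_d -> Xn n -> R) (eps : R),
    continuous_family f -> 0 < eps ->
    exists h, [/\ continuous_family h, uniformly_close eps f h &
      forall x y, x <> y -> orbit_separated (Tn n) h x y]) ->
  embeds TT (@shift R d).
Proof.
move=> good.
(* Countably many compact sets that exhaust the pairs of distinct points: [i.1] is a coordinate and
   [i.2] bounds the distance there from below. *)
pose K (i : nat * nat) : set (XX * XX) :=
  [set p : XX * XX | i.2.+1%:R^-1 <= mdist (p.1 i.1) (p.2 i.1)].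
have cTT : continuous TT by apply: continuous_prod_map => i; case: (hT i).
have cTI : continuous (prod_map (fun i => X i) Tinv).
  by apply: continuous_prod_map => i; case: (TinvP i).
have cK i : compact (K i).
  apply: (@subclosed_compact _ _ ([set: XX] `*` [set: XX])) => //;
    last exact: compact_setX.
  rewrite (_ : K i = (fun p : XX * XX => mdist (p.1 i.1) (p.2 i.1)) @^-1`
    [set t | i.2.+1%:R^-1 <= t])//.
  apply: closed_comp; last exact: closed_ge.
  move=> p _; apply/cvgrPdist_lt => /= e e0.
  have e20 : 0 < e / 2 by rewrite divr_gt0.
  have near_coord (x : XX) :
      nbhs x [set y : XX | mdist (x i.1) (y i.1) < e / 2].
    apply: (@continuous_proj _ (fun i => X i) i.1 x
      [set y | mdist (x i.1) y < e / 2]).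
    exact: (cm_near (mdist_compatible (X i.1))).
  exists ([set y : XX | mdist (p.1 i.1) (y i.1) < e / 2],
          [set y : XX | mdist (p.2 i.1) (y i.1) < e / 2]).
    by split; exact: near_coord.
  move=> [y z] /= [py pz].
  have := metric_triangle (p.1 i.1) (y i.1) (p.2 i.1).
  have := metric_triangle (y i.1) (z i.1) (p.2 i.1).
  have := metric_triangle (y i.1) (p.1 i.1) (z i.1).
  have := metric_triangle (p.1 i.1) (p.2 i.1) (z i.1).
  rewrite (metric_sym (y i.1) (p.1 i.1)) (metric_sym (z i.1) (p.2 i.1)).
  rewrite ltr_norml => ? ? ? ?.
  by apply/andP; split; lra.
have dK i (f : 'I_d -> XX -> R) (eps : R) : continuous_family f -> 0 < eps ->
    exists f', [/\ continuous_family f', uniformly_close eps f f' &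
      forall x y, K i (x, y) -> orbit_separated TT f' x y].
  move=> cf e0; have e20 : 0 < eps / 2 by rewrite divr_gt0.
  have [N HN] := finite_coordinates_approx cf e20.
  (* Besides the approximation, [n] must include the coordinate [i.1], so that pairs in [K i] stay
     distinct in the partial product. *)
  have [n] := good (maxn N i.1.+1); rewrite geq_max => /andP[Nn i_n] Hn.
  have [|h [ch hf sh]] := Hn (fun c y => f c (extend y)) _ _ e20.
    by move=> c y; apply: continuous_comp; [exact: continuous_extend|exact: cf].
  exists (fun c x => h c (restrict n x)); split.
  - move=> c x; apply: continuous_comp; last exact: ch.
    exact: continuous_restrict.
  - move=> c x; have := hf c (restrict n x); have := HN n Nn c x.
    by rewrite !ler_norml => /andP[? ?] /andP[? ?]; apply/andP; split; lra.
  - move=> x y Kxy; have /sh[k [c hk]] : restrict n x <> restrict n y.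
      move=> /(congr1 (fun z : Xn n => z (Ordinal i_n))) xy.
      move: Kxy; rewrite /K /= [x i.1]xy mdistxx.
      by rewrite leNgt invr_gt0 ltr0Sn.
    by exists k, c; rewrite -!iter_restrict.
have c0 : continuous_family (fun (_ : 'I_d) (_ : XX) => 0 : R).
  by move=> c; exact: continuous_cst_fun.
have [h [ch _ sh]] := separate_countable_union cTT cK dK c0 ltr01.
apply: (@shift_embedding R XX TT (prod_map (fun i => X i) Tinv) d
  cXX cTT cTI _ h ch).
  by apply: prod_mapK => i; case: (TinvP i).
move=> x y xy.
have [i xyi] : exists i, x i <> y i.
  apply: contrapT => nxy; apply: xy; apply: functional_extensionality_dep => i.
  by apply: contrapT => xyi; apply: nxy; exists i.
have m0 : 0 < mdist (x i) (y i) by rewrite mdist_gt0; apply/eqP.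
have [k _ /(_ k (leqnn k)) /ltW km] := near_infty_natSinv_lt (PosNum m0).
exact: (sh (i, k)).
Qed.
End InfiniteProduct.

Lemma finite_topdim_dim_le (R : realType) (Y : topologicalType) :
  (topdim R Y < +oo)%E -> exists N, dim_le [set: Y] N.
Proof.
case: (topdim R Y) (@topdim_dim_le R Y) => [r|//|] H _.
  by exists (Num.truncn r); apply: H; rewrite lte_fin truncnS_gt.
by exists 0%N; exact: H (ltNyr _).
Qed.

(** The lower limit is the supremum of the tail infima, so each tail infimum is below [c]. *)
Lemma limn_einf_lt_frequently (R : realType) (u : (\bar R)^nat) (c : \bar R) N :
  (limn_einf u < c)%E -> exists2 n, (N <= n)%N & (u n < c)%E.
Proof.
move=> uc; have : (einfs u N < c)%E.
  apply: le_lt_trans uc.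
  rewrite limn_einf_lim (cvg_lim _ (@cvg_einfs_sup R u))//.
  by apply: ereal_sup_ubound; exists N.
by move=> /ereal_inf_lt[_ [n /= Nn <-] unc]; exists n.
Qed.

(** The dimension is below [k * d / 2], and [(k * d).-1./2] is the largest integer whose double is
    less than [k * d]. *)
Lemma periodic_points_dim_le (R : realType) (Y : topologicalType) (T : Y -> Y)
    (d k : nat) : (perdim R T < (d%:R / 2)%:E)%E -> (0 < k)%N -> (0 < d)%N ->
  dim_le (periodic_points T k) (k * d).-1./2.
Proof.
move=> Td k0 d0; apply/dim_le_subspace/(@topdim_dim_le R).
have : (topdim R (set_type (periodic_points T k)) * (k%:R^-1)%:E
    < (d%:R / 2)%:E)%E.
  by apply: le_lt_trans Td; apply: ereal_sup_ubound; exists k.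
rewrite lte_pdivrMr ?ltr0n// -EFinM => /lt_le_trans; apply; rewrite lee_fin.
rewrite mulrAC ler_pdivrMr// -!natrM ler_nat mulnC.
have := odd_double_half (k * d).-1; have : (0 < k * d)%N by rewrite muln_gt0 k0.
by rewrite -muln2; case: odd => /=; lia.
Qed.

Theorem proposition26 (R : realType) (d : nat) (X : nat -> metricType R)
    (T : forall i, X i -> X i) :
  (1 <= d)%N ->
  (forall i, [set: X i] !=set0) ->
  (forall i, compact [set: X i]) ->
  (forall i, (topdim R (X i) < +oo)%E) ->
  (forall i, homeomorphism (T i)) ->
  (limn_einf (fun n => perdim R (partial_map (fun i => X i) T n))
   < (d%:R / 2)%:E)%E ->
  embeds (prod_map (fun i => X i) T) (@shift R d).
Proof.
move=> d0 X0 cX dX hT perT; apply: product_embedding => // N.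
have [n Nn nd] := limn_einf_lt_frequently N perT; exists n => // f eps cf e0.
have [M HM] : exists M, dim_le [set: partial_prod (fun i => X i) n] M.
  apply: (@dim_le_prod R n (fun i => X i) (fun i => cX i)
    (fun i => projT1 (cid (finite_topdim_dim_le (dX i))))).
    by exists (fun i => projT1 (cid (X0 i))).
  by move=> i; exact: projT2 (cid (finite_topdim_dim_le (dX i))).
pose S i := projT1 (cid (hT i).2).
have SP i : [/\ continuous (S i), cancel (T i) (S i) & cancel (S i) (T i)] :=
  projT2 (cid (hT i).2).
apply: (@finite_dim_separation R _ (@prod_dist R n (fun i => X i))
  (@prod_dist_compatible R n (fun i => X i))
  (prod_space_compact (fun i : 'I_n => cX i)) (partial_map (fun i => X i) T n)
  (partial_map (fun i => X i) S n) _ _ _ _ d M (fun k => (k * d).-1./2) d0 HM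
  _ _ f eps cf e0).
- by apply: continuous_prod_map => i; case: (hT i).
- by apply: continuous_prod_map => i; case: (SP i).
- by apply: prod_mapK => i; case: (SP i).
- by apply: prod_mapK => i; case: (SP i).
- by move=> k k0; exact: (periodic_points_dim_le nd).
- move=> k k0; have : (0 < k * d)%N by rewrite muln_gt0 k0.
  have := odd_double_half (k * d).-1.
  by rewrite -!muln2; case: odd => /=; lia.
Qed.
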